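(* Let $V\in\mathcal K$ be a measure. Then $V\in\mathcal K_0$ if and only if $V$ has the local Kato property, $V$ has the modified distal Kato property, and $V\in L^1_{loc}(\mathbb R^3)$.
   Context: The global Kato class $\mathcal K$ consists of the (possibly singular) measures $V$ on $\mathbb R^3$ of locally bounded variation for which $\|V\|_{\mathcal K}=\sup_{y\in\mathbb R^3}\int_{\mathbb R^3}\frac{d|V|(x)}{|x-y|}<\infty$; one writes $|V(x)|\,dx$ for $d|V|(x)$. $\mathcal K_0$ is the closure of $C_c^\infty(\mathbb R^3)$ in $\mathcal K$. The local Kato property is $\lim_{\epsilon\to0}\sup_{y\in\mathbb R^3}\int_{|x-y|<\epsilon}\frac{|V(x)|\,dx}{|x-y|}=0$. The modified distal Kato property is $\lim_{R\to\infty}\sup_{y\in\mathbb R^3}\int_{|x|>R}\frac{|V(x)|\,dx}{|x-y|}=0$. $V\in L^1_{loc}$ means that $V$ is absolutely continuous with locally integrable density. *)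

(* Defs.v *)
From HB Require Import structures.
From mathcomp Require Import all_boot all_order all_algebra.
From mathcomp Require Import all_classical all_reals all_analysis.

Set Implicit Arguments.
Unset Strict Implicit.
Unset Printing Implicit Defensive.

Import Order.TTheory GRing.Theory Num.Theory.
Import numFieldNormedType.Exports.

Local Open Scope classical_set_scope.
Local Open Scope ring_scope.

Notation R3 R := (R * R * R)%type.

(* R^3 with its Borel sets: the measurable type on which the product of
   lebesgue_measure, stated over measurableTypeR, is a measure. *)
Definition borelR3 (R : realType) : measurableType _ :=
  (measurableTypeR R * measurableTypeR R * measurableTypeR R)%type.

Section R3.
Variable R : realType.
Implicit Types (x y : R3 R) (f : R3 R -> R) (i : 'I_3).

(* The library norm on a product is the sup norm; it induces the same topology
   and bounded sets, but the Kato kernel needs the Euclidean distance. *)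
Definition edist x y : R :=
  Num.sqrt ((x.1.1 - y.1.1) ^+ 2 + (x.1.2 - y.1.2) ^+ 2 + (x.2 - y.2) ^+ 2).

Definition leb3 : {measure set (borelR3 R) -> \bar R} :=
  ((@lebesgue_measure R \x @lebesgue_measure R) \x @lebesgue_measure R)%E.

Definition basis3 i : R3 R := ((i == 0 :> nat)%:R, (i == 1 :> nat)%:R, (i == 2 :> nat)%:R).

Definition partial i f : R3 R -> R := fun x => 'D_(basis3 i) f x.

Definition smooth f := forall s : seq 'I_3,
  continuous (foldr partial f s) /\
  forall i x, derivable (foldr partial f s) x (basis3 i).

Definition Ccinfty f := smooth f /\ compact (closure [set x | f x != 0]).

(* Locally integrable functions are defined in the library on R only. *)
Definition loc_integrable3 f := measurable_fun setT (f : borelR3 R -> R) /\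
  forall K, compact K -> (\int[leb3]_(x in K) `|f x|%:E < +oo)%E.

End R3.

(* A signed measure V on R^3 that is only locally of bounded variation may be
   undefined on unbounded sets (its positive and negative parts may both be
   infinite there). It is therefore represented by a real-valued set function
   of which only the values on bounded Borel sets are meaningful. *)
Section LocalSignedMeasure.
Variable R : realType.
Implicit Types (V : set (R3 R) -> R) (A D : set (borelR3 R)) (f : R3 R -> R).

(* The total variation |V|, a measure on all Borel sets when V is a
   loc_measure; the library integral only needs the underlying set function.
   Countable families or partitions of A would give the same supremum. *)
Definition tvar V : set (borelR3 R) -> \bar R := fun A => ereal_sup
  [set s | exists n (F : (set (borelR3 R))^nat),
    [/\ forall k, [/\ measurable (F k), bounded_set (F k : set (R3 R)) & F k `<=` A],
        trivIset setT F
      & s = (\sum_(k < n) `|V (F k)|)%:E]].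

Definition loc_bounded_variation V := forall A,
  measurable A -> bounded_set (A : set (R3 R)) -> (tvar V A < +oo)%E.

Definition loc_measure V :=
  [/\ V set0 = 0,
      forall F : (set (borelR3 R))^nat, (forall k, measurable (F k)) ->
        trivIset setT F -> bounded_set (\bigcup_k F k : set (R3 R)) ->
        series (V \o F) @ \oo --> V (\bigcup_k F k)
    & loc_bounded_variation V].

(* The measure f dx. *)
Definition density f A : R := \int[@leb3 R]_(x in A) f x.

Definition abs_continuous_L1loc V := exists f, loc_integrable3 f /\
  forall A, measurable A -> bounded_set (A : set (R3 R)) -> V A = density f A.

(* int_D d|V|(x) / |x - y|.  The inverse is that of \bar R, so that the kernel
   is +oo at x = y. *)
Definition kato_potential V D (y : R3 R) : \bar R :=
  (\int[tvar V]_(x in D) ((edist x y)%:E)^-1)%E.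

Definition kato_norm V : \bar R := ereal_sup (range (kato_potential V setT)).

Definition kato V := loc_measure V /\ (kato_norm V < +oo)%E.

(* Norm closure of C_c^oo in the Kato class, phi being identified with phi dx. *)
Definition kato0 V := kato V /\ forall e : R, 0 < e ->
  exists phi, Ccinfty phi /\ (kato_norm (V \- density phi)%R < e%:E)%E.

Definition local_kato V :=
  (fun e : R => ereal_sup
     (range (fun y => kato_potential V [set x | edist x y < e] y)))
    @ 0^'+ --> 0%E.

Definition modified_distal_kato V :=
  (fun r : R => ereal_sup
     (range (kato_potential V [set x | r < edist x 0])))
    @ +oo --> 0%E.

End LocalSignedMeasure.

(* Main.v *)
(* If V is approximated in Kato norm by phi dx with phi in C_c^oo, then, 1/|x - y|
   being bounded below on bounded sets, so is |V| on every bounded set: hence V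
   vanishes on bounded null sets and has a density f by Radon-Nikodym.  Then |V| is
   |f| dx and all Kato quantities become integrals of |f x| / |x - y|, for which the
   local and distal properties pass from phi to f up to the Kato norm of f - phi.

   Conversely, let V = f dx.  The distal property discards f outside a large box.
   For the rest, the local property reduces Kato convergence to L^1 convergence: if
   the g_n are dominated by a function with the local Kato property which is
   integrable on a box supporting them, and g_n -> 0 pointwise, then their Kato
   norms tend to 0, because near y the kernel is handled by the local property and
   away from y it is bounded.  This is used three times: to pass from smooth bumps
   to the indicators of boxes, from boxes to Borel sets (Dynkin), and from simple
   functions to f. *)
Require Import Defs.
From HB Require Import structures.
From mathcomp Require Import all_boot all_order all_algebra.
From mathcomp Require Import all_classical all_reals all_analysis.
From mathcomp Require Import measurable_realfun ring lra.

Set Implicit Arguments.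
Unset Strict Implicit.
Unset Printing Implicit Defensive.

Import Order.TTheory GRing.Theory Num.Theory.
Import numFieldNormedType.Exports.

Local Open Scope classical_set_scope.
Local Open Scope ring_scope.

(* all_analysis has another edist *)
Local Notation edist := Defs.edist.

(** * The kernel and the Borel sets of R^3 *)

Definition kernel3 (R : realType) (y x : R3 R) : \bar R := ((edist x y)%:E)^-1%E.

Lemma edist3_ge0 (R : realType) (x y : R3 R) : 0 <= edist x y.
Proof. exact: sqrtr_ge0. Qed.

Lemma edist_coordP (R : realType) (x y : R3 R) :
  [/\ `|x.1.1 - y.1.1| <= edist x y, `|x.1.2 - y.1.2| <= edist x y
    & `|x.2 - y.2| <= edist x y].
Proof.
by split; rewrite -sqrtr_sqr ler_wsqrtr//;
  have := sqr_ge0 (x.1.1 - y.1.1); have := sqr_ge0 (x.1.2 - y.1.2);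
  have := sqr_ge0 (x.2 - y.2); lra.
Qed.

Lemma edist_le_sum (R : realType) (x y : R3 R) :
  edist x y <= `|x.1.1 - y.1.1| + `|x.1.2 - y.1.2| + `|x.2 - y.2|.
Proof.
rewrite -[leRHS]ger0_norm ?addr_ge0// -sqrtr_sqr ler_wsqrtr//.
rewrite -(real_normK (num_real (x.1.1 - _))) -(real_normK (num_real (x.1.2 - _))).
rewrite -(real_normK (num_real (x.2 - _))).
have := normr_ge0 (x.1.1 - y.1.1); have := normr_ge0 (x.1.2 - y.1.2).
have := normr_ge0 (x.2 - y.2); nra.
Qed.

Lemma measurable_edist (R : realType) (y : R3 R) :
  measurable_fun setT (fun x : borelR3 R => edist x y).
Proof.
(* The square root is written as the power 1/2, so that [measurable_powR] applies. *)
have -> : (fun x : borelR3 R => edist x y) = (fun x : borelR3 R =>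
    ((x.1.1 - y.1.1) ^+ 2 + (x.1.2 - y.1.2) ^+ 2 + (x.2 - y.2) ^+ 2) `^ 2^-1).
  apply/funext => x; rewrite powR12_sqrt//.
  by rewrite !addr_ge0// sqr_ge0.
apply: (measurableT_comp (measurable_powR _)).
have m11 : measurable_fun setT (fun x : borelR3 R => x.1.1).
  exact: measurableT_comp measurable_fst measurable_fst.
have m12 : measurable_fun setT (fun x : borelR3 R => x.1.2).
  exact: measurableT_comp measurable_snd measurable_fst.
have m2 : measurable_fun setT (fun x : borelR3 R => x.2).
  exact: measurable_snd.
by repeat apply: measurable_funD; apply: measurable_funX; apply: measurable_funB.
Qed.

Lemma kernel3_ge0 (R : realType) (x y : R3 R) : (0 <= kernel3 y x)%E.
Proof. by rewrite /kernel3 inve_ge0 lee_fin edist3_ge0. Qed.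

Lemma kernel3E (R : realType) (x y : R3 R) :
  kernel3 y x = if edist x y == 0 then +oo%E else ((edist x y)^-1)%:E.
Proof. by rewrite /kernel3 inver. Qed.

Lemma measurable_kernel3 (R : realType) (y : R3 R) :
  measurable_fun setT (kernel3 y : borelR3 R -> \bar R).
Proof.
have -> : (kernel3 y : borelR3 R -> \bar R) = fun x =>
    if edist x y == 0 then +oo%E else (edist x y `^ (-1))%:E.
  by apply/funext => x; rewrite kernel3E powR_inv1// edist3_ge0.
have medist := @measurable_edist R y.
apply: measurable_fun_ifT => //.
- exact: measurable_fun_eqr.
- by apply/measurable_EFinP; apply: (measurableT_comp (measurable_powR _)).
Qed.

(** An open set is the union of the sup-norm balls with rational centre and radius [1/(n+1)] that it
    contains. There are countably many of these, and each is a product of intervals, hence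
    measurable for the product sigma-algebra. *)
Lemma open_measurable3 (R : realType) (A : set (R3 R)) :
  open A -> measurable (A : set (borelR3 R)).
Proof.
move=> oA.
pose c (q : rat * rat * rat) : R3 R := (ratr q.1.1, ratr q.1.2, ratr q.2).
pose I : set (rat * rat * rat * nat) := [set q | ball (c q.1) q.2.+1%:R^-1 `<=` A].
have -> : A = \bigcup_(q in I) ball (c q.1) q.2.+1%:R^-1.
  apply/seteqP; split=> [x Ax|x [q Iq]]; last exact: Iq.
  have [e/= e0 eA] : exists2 e : R, 0 < e & ball x e `<=` A.
    by have /nbhs_ballP := open_nbhs_nbhs (conj oA Ax).
  (* A ball of this radius that contains [x] has all its points within [e] of [x], hence lies in
     [A]. *)
  have [n ne] : exists n, n.+1%:R^-1 < e / 2 :> R.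
    have e20 : 0 < e / 2 by rewrite divr_gt0.
    have [n _ h] := near_infty_natSinv_lt (PosNum e20).
    by exists n; exact: h (leqnn n).
  have n0 : 0 < n.+1%:R^-1 :> R by rewrite invr_gt0.
  have rat_near (t : R) : exists q : rat, `|ratr q - t| < n.+1%:R^-1.
    have [|q] := @rat_in_itvoo R (t - n.+1%:R^-1) (t + n.+1%:R^-1).
      by rewrite ltrBlDr -addrA ltrDl addr_gt0.
    by rewrite in_itv/= -ltr_distl => h; exists q.
  have [q1 h1] := rat_near x.1.1.
  have [q2 h2] := rat_near x.1.2.
  have [q3 h3] := rat_near x.2.
  exists ((q1, q2, q3), n); last by [].
  move=> y [[/= y1 y2] y3]; apply: eA.
  move: y1 y2 y3; rewrite /ball/= /ball/= /c/= => y1 y2 y3.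
  have tri (q a b : R) : `|q - a| < n.+1%:R^-1 -> `|q - b| < n.+1%:R^-1 -> `|a - b| < e.
    move=> qa qb; rewrite (le_lt_trans (ler_distD q _ _))// distrC.
    by rewrite [ltRHS]splitr ltrD// (lt_trans _ ne).
  by split; [split|]; [exact: tri h1 y1|exact: tri h2 y2|exact: tri h3 y3].
rewrite bigcup_mkcond.
apply: countable_bigcupT_measurable; first exact: countableP.
move=> q; case: ifPn => // _.
have -> : ball (c q.1) q.2.+1%:R^-1 = (ball (c q.1).1.1 q.2.+1%:R^-1 `*`
    ball (c q.1).1.2 q.2.+1%:R^-1) `*` ball (c q.1).2 q.2.+1%:R^-1.
  by apply/seteqP; split => y [[]].
by apply: measurableX; [apply: measurableX|]; exact: measurable_ball.
Qed.

Lemma compact_measurable3 (R : realType) (K : set (R3 R)) :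
  compact K -> measurable (K : set (borelR3 R)).
Proof.
move=> cK; rewrite -[K]setCK; apply: measurableC; apply: open_measurable3.
by apply: closed_openC; exact: compact_closed (@norm_hausdorff _ _) cK.
Qed.

Lemma continuous_measurable3 (R : realType) (f : R3 R -> R) :
  continuous f -> measurable_fun setT (f : borelR3 R -> R).
Proof.
move=> /continuousP cf; apply: (measurability _ (RGenOpens.measurableE R)).
move=> _ [_ [a [b ->]] <-]; rewrite setTI; apply: open_measurable3; apply: cf.
exact: interval_open.
Qed.

(** * Integrals with respect to a density and to a set function *)

Section weighted_measure.
Context d (T : measurableType d) (R : realType) (mu : {measure set T -> \bar R}).
Variable f : T -> R.
Hypotheses (mf : measurable_fun setT f) (f0 : forall x, 0 <= f x).

(** The two proofs are arguments so that the measure structure declared below can be inferred from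
    the term itself. *)
Definition weighted_measure of measurable_fun setT f & (forall x, 0 <= f x) :=
  fun A => (\int[mu]_(x in A) (f x)%:E)%E.

Local Notation nu := (weighted_measure mf f0).

Let nu0 : nu set0 = 0%E. Proof. by rewrite /nu integral_set0. Qed.

Let nu_ge0 A : (0 <= nu A)%E.
Proof. by apply: integral_ge0 => x _; rewrite lee_fin. Qed.

Let nu_sigma_additive : semi_sigma_additive nu.
Proof.
apply: semi_sigma_additive_nng_induced => [|x]; last by rewrite lee_fin.
exact/measurable_EFinP.
Qed.

HB.instance Definition _ := isMeasure.Build _ _ _ nu nu0 nu_ge0 nu_sigma_additive.

Import HBNNSimple.

(** By monotone convergence both sides are limits along the increasing simple approximations of [h].
    A simple function is a finite combination of indicators, for which the identity is the
    definition of the weighted measure. *)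
Lemma ge0_integral_weighted (h : T -> \bar R) E : (forall x, 0 <= h x)%E ->
    measurable E -> measurable_fun E h ->
  (\int[nu]_(x in E) h x = \int[mu]_(x in E) ((f x)%:E * h x))%E.
Proof.
move=> h0 mE mh; pose g := nnsfun_approx mE mh.
have mf' : measurable_fun E (EFin \o f).
  by apply: measurable_funTS; exact/measurable_EFinP.
have mg n : measurable_fun E (fun x => (g n x)%:E).
  by apply/measurable_EFinP; apply: measurable_funTS; exact: measurable_funP.
transitivity (limn (fun n => \int[nu]_(x in E) (g n x)%:E)%E).
  rewrite -monotone_convergence//.
  - apply: eq_integral => x /[!inE] Ex; apply/esym/cvg_lim => //.
    exact: cvg_nnsfun_approx.
  - by move=> n x Ex; rewrite lee_fin.
  - by move=> x Ex a b ab; rewrite lee_fin; exact/lefP/nd_nnsfun_approx.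
transitivity (limn (fun n => \int[mu]_(x in E) ((f x)%:E * (g n x)%:E))%E); last first.
  rewrite -monotone_convergence//.
  - apply: eq_integral => x /[!inE] Ex; apply/cvg_lim => //.
    by apply: cvgeZl => //; exact: cvg_nnsfun_approx.
  - by move=> n; apply: emeasurable_funM.
  - by move=> n x Ex; rewrite mule_ge0// lee_fin.
  - move=> x Ex a b ab; rewrite lee_wpmul2l ?lee_fin//.
    exact/lefP/nd_nnsfun_approx.
congr (limn _); apply/funext => n.
have indich r : measurable_fun E (fun x => (r * \1_(g n @^-1` [set r]) x)%:E).
  by apply: (measurable_comp measurableT) => //; exact: measurable_funM.
transitivity (\int[nu]_(x in E)
   (\sum_(y \in range (g n)) (y * \1_(g n @^-1` [set y]) x)%:E))%E.
  by apply: eq_integral => t tE; rewrite {1}fimfunE -fsumEFin.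
rewrite ge0_integral_fsum//; last by move=> m y Ey; exact: nnfun_muleindic_ge0.
transitivity (\int[mu]_(x in E) (\sum_(y \in range (g n))
    ((f x)%:E * (y * \1_(g n @^-1` [set y]) x)%:E)))%E; last first.
  apply: eq_integral => x _.
  rewrite -ge0_mule_fsumr => [|y]; last exact: nnfun_muleindic_ge0.
  by rewrite fsumEFin // -fimfunE.
rewrite ge0_integral_fsum//; last 2 first.
  - by move=> y; exact: emeasurable_funM.
  - move=> m y Ey; apply: mule_ge0; first by rewrite lee_fin.
    exact: nnfun_muleindic_ge0.
apply: eq_fsbigr => r /[!inE] -[t _ gtr].
rewrite integralZl_indic_nnsfun//.
under [RHS]eq_integral do rewrite EFinM muleCA.
rewrite ge0_integralZl//.
- congr (_ * _)%E; rewrite integral_indic// setIC.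
  transitivity (\int[mu]_(x in E `&` g n @^-1` [set r]) (f x)%:E)%E; first by [].
  rewrite integral_mkcondr.
  by apply: eq_integral => x _; rewrite epatch_indic.
- by apply: emeasurable_funM => //; exact/measurable_EFinP.
- by move=> x _; rewrite mule_ge0 ?lee_fin.
- by rewrite -gtr lee_fin.
Qed.

End weighted_measure.

Section integral_set_function.
Context d (T : measurableType d) (R : realType).
Local Open Scope ereal_scope.
Import HBNNSimple.

(** The integral sees a set function only through fibres of simple functions, which are measurable.
    This allows [tvar V], which carries no measure structure, to be replaced by a genuine
    measure. *)
Lemma eq_set_function_integral (m1 m2 : set T -> \bar R) (D : set T) (f : T -> \bar R) :
    (forall A, measurable A -> m1 A = m2 A) ->
  \int[m1]_(x in D) f x = \int[m2]_(x in D) f x.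
Proof.
move=> m12.
have e (h : {nnsfun T >-> R}) : sintegral m1 h = sintegral m2 h.
  by rewrite /sintegral; apply: eq_fsbigr => r _; rewrite m12.
rewrite /integral; congr (ereal_sup _ - ereal_sup _); apply/seteqP; split;
  by move=> _ [h hf <-]; exists h => //; rewrite e.
Qed.

(** The simple function equal to [c] on [A] and 0 elsewhere lies below [f] on [D], so it enters the
    supremum defining the integral. Additivity of [m] is not assumed, so the bound applies to
    [tvar V] before any density is known. *)
Lemma set_function_integral_ge_cst (m : set T -> \bar R) (A D : set T)
    (f : T -> \bar R) (c : R) :
    m set0 = 0 -> measurable A -> A `<=` D -> (0 < c)%R ->
    (forall x, 0 <= f x) -> (forall x, A x -> c%:E <= f x) ->
  c%:E * m A <= \int[m]_(x in D) f x.
Proof.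
move=> m0 mA AD c0 f0 cf.
have fD0 x : 0 <= (f \_ D) x by apply: erestrict_ge0.
have sintegral_cst0 (h : {nnsfun T >-> R}) : (forall x, h x = 0%R) -> sintegral m h = 0.
  move=> h0; rewrite /sintegral fsbig1// => r _.
  have [->|r0] := eqVneq r 0%R; first by rewrite mul0e.
  rewrite (_ : h @^-1` [set r] = set0) ?m0 ?mule0//.
  by apply/seteqP; split => // x /=; rewrite h0 => /esym/eqP; rewrite (negbTE r0).
pose nn g := ereal_sup [set sintegral m h | h in
  [set h : {nnsfun T >-> R} | forall x, (h x)%:E <= g x]].
(* Only the supremum for the positive part remains: a nonnegative simple function below 0 vanishes,
   and its integral is 0 because [m set0 = 0]. *)
have -> : \int[m]_(x in D) f x = nn (f \_ D).
  rewrite /integral -/(nn _) -/(nn _).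
  have -> : (f \_ D)^\+ = f \_ D by apply/funext => x; rewrite (@ge0_funeposE _ _ setT)// inE.
  have -> : (f \_ D)^\- = cst 0 by apply/funext => x; rewrite (@ge0_funenegE _ _ setT)// inE.
  suff -> : nn (cst 0) = 0 by rewrite sube0.
  rewrite /nn -[RHS](@ereal_sup1 _ 0); congr ereal_sup.
  apply/seteqP; split => [_ [h h0 <-]|_ ->].
    rewrite /= sintegral_cst0// => x; apply/eqP; rewrite eq_le -lee_fin h0/=.
    exact: fun_ge0.
  by exists nnsfun0; rewrite // sintegral_cst0.
pose h := scale_nnsfun (indic_nnsfun R mA) (ltW c0).
have hE x : h x = (c * \1_A x)%R by [].
apply: ereal_sup_ubound => /=; exists h => [x|].
  rewrite hE indicE /patch; case: ifPn => xD.
    by have [/set_mem|] := boolP (x \in A); rewrite ?mulr1 ?mulr0//; exact: cf.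
  by rewrite memNset ?mulr0// => /AD; move: xD; rewrite notin_setE.
(* Only the value [c] contributes: the value 0 has weight 0, and the fibres over other values are
   empty. *)
rewrite /sintegral -(fsbig_widen [set c] setT)//=; last first.
  move=> r [_ /= rc].
  have [->|r0] := eqVneq r 0%R; first by rewrite mul0e.
  rewrite (_ : h @^-1` [set r] = set0) ?m0 ?mule0//.
  apply/seteqP; split => // x hx; have : h x = r := hx; rewrite hE indicE.
  case: (x \in A); rewrite ?mulr1 ?mulr0; first by move/esym.
  by move=> /esym/eqP; rewrite (negbTE r0).
rewrite fsbig_set1; congr (_ * m _); apply/seteqP; split => x; last first.
  move=> Ax; suff : h x = c by [].
  by rewrite hE indicE mem_set// mulr1.
move=> hx; have : h x = c := hx; rewrite hE indicE.
have [/set_mem//|_] := boolP (x \in A).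
by rewrite mulr0 => /esym/eqP; rewrite gt_eqF.
Qed.

End integral_set_function.

(** * The total variation of a measure with a density *)

Section bounded3.
Variable R : realType.
Implicit Types (A : set (R3 R)) (x y : R3 R).

Lemma ball3E y (r : R) : (ball y r : set (R3 R)) =
  (ball y.1.1 r `*` ball y.1.2 r) `*` ball y.2 r.
Proof. by apply/seteqP; split => x [[]]. Qed.

Lemma measurable_ball3 y r : measurable (ball y r : set (borelR3 R)).
Proof.
by rewrite ball3E; apply: measurableX; [apply: measurableX|]; exact: measurable_ball.
Qed.

Lemma ball3_coordP x y r :
  ball y r x <-> [/\ `|x.1.1 - y.1.1| < r, `|x.1.2 - y.1.2| < r & `|x.2 - y.2| < r].
Proof.
rewrite ball3E /ball/= !(distrC x.1.1) !(distrC x.1.2) !(distrC x.2).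
by split=> [[[]]|[]].
Qed.

Lemma edist_lt_ball3 x y r : edist x y < r -> ball y r x.
Proof.
move=> xyr; have [h1 h2 h3] := edist_coordP x y.
by apply/ball3_coordP; split; exact: le_lt_trans xyr.
Qed.

Lemma ball3_edist x y r : ball y r x -> edist x y < 3 * r.
Proof.
move=> /ball3_coordP[h1 h2 h3]; rewrite (le_lt_trans (edist_le_sum _ _))//.
have -> : 3 * r = r + r + r by ring.
by rewrite ltrD// ltrD.
Qed.

Lemma compact_cube3 (M : R) :
  compact ((`[- M, M] `*` `[- M, M]) `*` `[- M, M] : set (R3 R)).
Proof. by apply: compact_setX; [apply: compact_setX|]; exact: segment_compact. Qed.

Lemma ball3_subset_cube3 (M : R) :
  ball (0 : R3 R) M `<=` (`[- M, M] `*` `[- M, M]) `*` `[- M, M].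
Proof.
move=> x /ball3_coordP; rewrite /= !subr0 => -[h1 h2 h3].
by split; [split|]; rewrite /= in_itv/= -ler_norml ltW.
Qed.

Lemma bounded_set_ball3 A : bounded_set A -> exists n, A `<=` ball (0 : R3 R) n.+1%:R.
Proof.
move=> /ex_strict_bound_gt0[M M0 AM].
exists (Num.truncn M) => x Ax.
rewrite prod_norm_ball /ball_/= sub0r normrN (lt_trans (AM _ Ax))//.
exact: truncnS_gt.
Qed.

Lemma ball3_bounded y r : bounded_set (ball y r : set (R3 R)).
Proof.
exists (`|y| + r); split; first exact: num_real.
move=> M /ltW yrM x; rewrite prod_norm_ball /ball_/= => yxr.
rewrite (le_trans _ yrM)// -[x](subrK y) (le_trans (ler_normD _ _))//.
by rewrite addrC lerD2l distrC ltW.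
Qed.

Lemma bounded_subset A B : A `<=` B -> bounded_set B -> bounded_set A.
Proof. by move=> AB; apply: sub_boundedr => P /= BP x /AB /BP. Qed.

Lemma bigcup_ball3 : \bigcup_n ball (0 : R3 R) n.+1%:R = setT.
Proof.
apply/seteqP; split => // x _; exists (Num.truncn `|x|) => //.
by rewrite prod_norm_ball /ball_/= sub0r normrN; exact: truncnS_gt.
Qed.

(** Balls of the sup norm are cubes of side [2 r]. *)
Lemma leb3_ball y r : 0 <= r -> leb3 R (ball y r) = ((2 * r) ^+ 3)%:E.
Proof.
move=> r0; rewrite ball3E.
have mb (z : R) : measurable (ball z r : set (measurableTypeR R)) by exact: measurable_ball.
apply: (etrans (@product_measure1E _ _ _ _ R (lebesgue_measure \x lebesgue_measure)%E
  lebesgue_measure (ball y.1.1 r `*` ball y.1.2 r) (ball y.2 r) _ _)) => //.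
  exact: measurableX.
transitivity ((r *+ 2)%:E * (r *+ 2)%:E * (r *+ 2)%:E)%E; last first.
  by rewrite -!EFinM; congr EFin; ring.
congr (_ * _)%E; last exact: lebesgue_measure_ball.
apply: (etrans (@product_measure1E _ _ _ _ R lebesgue_measure lebesgue_measure
  (ball y.1.1 r) (ball y.1.2 r) _ _)) => //.
by congr (_ * _)%E; exact: lebesgue_measure_ball.
Qed.

End bounded3.

Section loc_integrable3.
Variable R : realType.
Implicit Types (f : R3 R -> R) (A : set (borelR3 R)).
Local Notation mu := (leb3 R).

Lemma loc_integrable3_integrable f A : loc_integrable3 f -> measurable A ->
  bounded_set (A : set (R3 R)) -> mu.-integrable A (EFin \o f).
Proof.
move=> [mf fK] mA /bounded_set_ball3[n An].
pose C : set (R3 R) := (`[- n.+1%:R, n.+1%:R] `*` `[- n.+1%:R, n.+1%:R]) `*` `[- n.+1%:R, n.+1%:R].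
have AC : A `<=` C by apply: (subset_trans An); exact: ball3_subset_cube3.
have mC := compact_measurable3 (@compact_cube3 R n.+1%:R).
apply: (@integrableS _ _ _ mu C) => //.
apply/integrableP; split; first by apply/measurable_EFinP; exact: measurable_funTS.
exact: fK (@compact_cube3 R n.+1%:R).
Qed.

(** For the upper bound, [|V|] on each disjoint piece is at most the integral of [|f|]. For the
    lower bound, splitting a bounded set by the sign of [f] already attains the integral of
    [|f|]. *)
Lemma tvar_density f (V : set (R3 R) -> R) : loc_integrable3 f ->
    (forall A, measurable A -> bounded_set (A : set (R3 R)) -> V A = density f A) ->
  forall A, measurable A -> tvar V A = (\int[mu]_(x in A) `|f x|%:E)%E.
Proof.
move=> lf Vf A mA; have [mf _] := lf.
have mnf : measurable_fun setT (fun x : borelR3 R => `|f x|%:E).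
  by apply/measurable_EFinP; exact: measurableT_comp.
have nf0 B (x : borelR3 R) : B x -> (0 <= `|f x|%:E)%E by rewrite lee_fin.
apply/eqP; rewrite eq_le; apply/andP; split.
  apply: ge_ereal_sup => _ [n [F [FP tF ->]]].
  rewrite -sumEFin.
  apply: (@le_trans _ _ (\int[mu]_(x in \big[setU/set0]_(k < n) F k) `|f x|%:E)%E).
    rewrite -(big_mkord xpredT) ge0_integral_bigsetU//=; last 4 first.
    - by move=> k; have [] := FP k.
    - exact: iota_uniq.
    - exact: sub_trivIset tF.
    - exact: measurable_funTS.
    rewrite big_mkord; apply: lee_sum => k _.
    have [mFk bFk _] := FP k.
    rewrite Vf// /density -abse_EFin fineK; last first.
      by apply: integrable_fin_num => //; exact: loc_integrable3_integrable.
    by apply: le_abse_integral => //; exact/measurable_EFinP/measurable_funTS.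
  apply: ge0_subset_integral => //.
  - by apply: bigsetU_measurable => k _; have [] := FP k.
  - exact: measurable_funTS.
  - by move=> x; rewrite -bigcup_mkord => -[k _ Fkx]; have [_ _] := FP k; apply.
(* The pieces allowed in [tvar] are bounded, so [A] is exhausted by its intersections with balls. *)
pose b n : set (borelR3 R) := ball (0 : R3 R) n.+1%:R.
have cv : (\int[mu]_(x in A `&` b n) `|f x|%:E)%E @[n --> \oo] -->
    (\int[mu]_(x in \bigcup_n (A `&` b n)) `|f x|%:E)%E.
  apply: ge0_nondecreasing_set_cvg_integral => //.
  - move=> m n mn; apply/subsetPset; apply: setIS => x.
    by apply: le_ball; rewrite ler_nat.
  - by move=> n; apply: measurableI => //; exact: measurable_ball3.
  - by move=> n; exact: measurable_funTS.
have UA : \bigcup_n (A `&` b n) = A.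
  rewrite -setI_bigcupr; apply/setIidPl => x _.
  by rewrite bigcup_ball3.
rewrite UA in cv; apply: (cvge_le _ cv); apply: nearW => n.
set B := A `&` _; have mB : measurable B.
  by apply: measurableI => //; exact: measurable_ball3.
have bB : bounded_set (B : set (R3 R)).
  by apply: bounded_subset (ball3_bounded 0 n.+1%:R) => x [].
(* A Hahn decomposition of [B]: on each of the two pieces [f] has constant sign, so the integral of
   [|f|] is the absolute value of the integral of [f]. *)
pose P := B `&` [set x | 0 <= f x]; pose N := B `\` P.
have mP : measurable P by apply: measurable_fun_le => //; exact: measurable_funTS.
have mN : measurable N by exact: measurableD.
have bC C : C `<=` B -> bounded_set (C : set (R3 R)).
  by move=> CB; apply: bounded_subset bB.
have PB : P `<=` B by move=> ? [].
have NB : N `<=` B by move=> ? [].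
have BA : B `<=` A := @subIsetl _ _ _.
have VE C : measurable C -> C `<=` B ->
    (\int[mu]_(x in C) `|f x|%:E = `|\int[mu]_(x in C) (f x)%:E|)%E ->
    (\int[mu]_(x in C) `|f x|%:E)%E = `|V C|%:E.
  move=> mC CB ->; have bC' := bC _ CB.
  rewrite Vf// /density -abse_EFin fineK//; apply: integrable_fin_num => //.
  exact: loc_integrable3_integrable.
apply: ereal_sup_ubound => /=; exists 2%N, (bigcup2 P N); split.
- move=> [|[|k]]; rewrite /bigcup2/=; split=> //.
  + exact: bC.
  + exact: subset_trans PB BA.
  + exact: bC.
  + exact: subset_trans NB BA.
  + exact: bC.
- by rewrite -trivIset_bigcup2; apply/seteqP; split => // x [? []].
- rewrite big_ord_recl big_ord1/= /bigcup2/= EFinD -!VE//.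
  + rewrite -ge0_integral_setU//.
    * by rewrite setDUK.
    * exact: measurable_funTS.
    * by apply/disj_setPS => x [? []].
  + have -> : (\int[mu]_(x in N) (f x)%:E = \int[mu]_(x in N) (- `|f x|%:E))%E.
      apply: eq_integral => x /[!inE] -[Bx Px]; rewrite ltr0_norm ?EFinN ?oppeK//.
      by rewrite ltNge; apply/negP => fx0; apply: Px.
    by rewrite integral_ge0N// abseN gee0_abs// integral_ge0.
  + have -> : (\int[mu]_(x in P) (f x)%:E = \int[mu]_(x in P) `|f x|%:E)%E.
      by apply: eq_integral => x /[!inE] -[Bx Px]; rewrite ger0_norm.
    by rewrite gee0_abs// integral_ge0.
Qed.

End loc_integrable3.

(** * Kato integrals of functions *)

Section kato_integral.
Variable R : realType.
Implicit Types (f g h : R3 R -> R) (A D : set (borelR3 R)) (x y : R3 R).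
Local Notation mu := (leb3 R).

Definition kato_integral f D y : \bar R :=
  (\int[mu]_(x in D) (`|f x|%:E * kernel3 y x))%E.

Definition eball3 y (r : R) : set (borelR3 R) := [set x | edist x y < r].

Lemma measurable_eball3 y r : measurable (eball3 y r).
Proof.
have := @measurable_edist R y measurableT _ (measurable_itv `]-oo, r[).
by rewrite setTI; congr measurable; apply/seteqP; split => x; rewrite /= in_itv.
Qed.

Lemma eball3_ball y r : eball3 y r `<=` ball y r.
Proof. by move=> x; exact: edist_lt_ball3. Qed.

Lemma measurable_kato_integrand f y : measurable_fun setT (f : borelR3 R -> R) ->
  measurable_fun setT (fun x : borelR3 R => `|f x|%:E * kernel3 y x)%E.
Proof.
move=> mf; apply: emeasurable_funM; last exact: measurable_kernel3.
by apply/measurable_EFinP; exact: measurableT_comp.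
Qed.

Lemma kato_integrand_ge0 f y x : (0 <= `|f x|%:E * kernel3 y x)%E.
Proof. by rewrite mule_ge0 ?lee_fin// kernel3_ge0. Qed.

Lemma kato_integral_ge0 f D y : (0 <= kato_integral f D y)%E.
Proof. by apply: integral_ge0 => x _; exact: kato_integrand_ge0. Qed.

Hint Resolve kato_integrand_ge0 kato_integral_ge0 : core.

(** By [tvar_density], [tvar V] agrees on measurable sets with the measure of weight [|f|]. From
    here on all estimates concern integrals against Lebesgue measure. *)
Lemma kato_potential_density f (V : set (R3 R) -> R) D y : loc_integrable3 f ->
    (forall A, measurable A -> bounded_set (A : set (R3 R)) -> V A = density f A) ->
  measurable D -> kato_potential V D y = kato_integral f D y.
Proof.
move=> lf Vf mD; have [mf _] := lf.
have mnf : measurable_fun setT (fun x : borelR3 R => `|f x|) by exact: measurableT_comp.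
have nf0 (x : borelR3 R) : 0 <= `|f x| by [].
rewrite /kato_potential (eq_set_function_integral (m2 := weighted_measure mu mnf nf0)).
  rewrite ge0_integral_weighted//; first by move=> x; exact: kernel3_ge0.
  by apply: measurable_funTS; exact: measurable_kernel3.
by move=> A mA; rewrite (tvar_density lf Vf).
Qed.

Lemma subset_kato_integral f A D y : measurable_fun setT (f : borelR3 R -> R) ->
  measurable A -> measurable D -> A `<=` D ->
  (kato_integral f A y <= kato_integral f D y)%E.
Proof.
move=> mf mA mD AD; apply: ge0_subset_integral => //.
by apply: measurable_funTS; exact: measurable_kato_integrand.
Qed.

Lemma kato_integral_setD f A D y : measurable_fun setT (f : borelR3 R -> R) ->
  measurable A -> measurable D ->
  (kato_integral f D y = kato_integral f (D `&` A) y + kato_integral f (D `\` A) y)%E.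
Proof.
move=> mf mA mD; rewrite /kato_integral -ge0_integral_setU//.
- by rewrite setUIDK.
- exact: measurableI.
- exact: measurableD.
- by apply: measurable_funTS; exact: measurable_kato_integrand.
- by apply/disj_setPS => x [[? ?] []].
Qed.

Lemma le_kato_integralD f g h D y : measurable_fun setT (f : borelR3 R -> R) ->
  measurable_fun setT (g : borelR3 R -> R) -> measurable_fun setT (h : borelR3 R -> R) ->
  measurable D -> (forall x, D x -> `|f x| <= `|g x| + `|h x|) ->
  (kato_integral f D y <= kato_integral g D y + kato_integral h D y)%E.
Proof.
move=> mf mg mh mD fgh; rewrite /kato_integral -ge0_integralD//.
- apply: ge0_le_integral => //.
  + by apply: measurable_funTS; exact: measurable_kato_integrand.
  + by apply: emeasurable_funD; apply: measurable_funTS; exact: measurable_kato_integrand.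
  + move=> x Dx; rewrite -ge0_muleDl ?lee_fin// -EFinD.
    by rewrite lee_wpmul2r ?kernel3_ge0// lee_fin fgh.
- by apply: measurable_funTS; exact: measurable_kato_integrand.
- by apply: measurable_funTS; exact: measurable_kato_integrand.
Qed.

Lemma le_kato_integral f g D y : measurable_fun setT (f : borelR3 R -> R) ->
  measurable_fun setT (g : borelR3 R -> R) ->
  measurable D -> (forall x, D x -> `|f x| <= `|g x|) ->
  (kato_integral f D y <= kato_integral g D y)%E.
Proof.
move=> mf mg mD fg; apply: ge0_le_integral => //.
- by apply: measurable_funTS; exact: measurable_kato_integrand.
- by apply: measurable_funTS; exact: measurable_kato_integrand.
- by move=> x Dx; rewrite lee_wpmul2r ?kernel3_ge0// lee_fin fg.
Qed.

Lemma kato_integralZ (c : R) f D y : measurable_fun setT (f : borelR3 R -> R) ->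
  measurable D ->
  (kato_integral (fun x => c * f x)%R D y = `|c|%:E * kato_integral f D y)%E.
Proof.
move=> mf mD; rewrite /kato_integral -ge0_integralZl//.
- by apply: eq_integral => x _; rewrite normrM EFinM muleA.
- by apply: measurable_funTS; exact: measurable_kato_integrand.
Qed.

Lemma kato_integral_far f D y (r : R) : measurable_fun setT (f : borelR3 R -> R) ->
  measurable D -> 0 < r -> (forall x, D x -> r <= edist x y) ->
  (kato_integral f D y <= r^-1%:E * \int[mu]_(x in D) `|f x|%:E)%E.
Proof.
move=> mf mD r0 Dr; rewrite -ge0_integralZl//.
- apply: ge0_le_integral => //.
  + by apply: measurable_funTS; exact: measurable_kato_integrand.
  + apply: measurable_funTS; apply/measurable_EFinP; apply: measurable_funM => //.
    exact: measurableT_comp.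
  + move=> x Dx; rewrite muleC lee_wpmul2r ?lee_fin// kernel3E.
    have e0 : 0 < edist x y by rewrite (lt_le_trans r0)// Dr.
    by rewrite gt_eqF// lee_fin lef_pV2 ?posrE// Dr.
- by apply/measurable_EFinP/measurable_funTS; exact: measurableT_comp.
- by rewrite lee_fin invr_ge0 ltW.
Qed.

(* Only the scale just above |x - y| matters; at x = y all terms are active and both
   sides are +oo. *)
Lemma kernel3_le_dyadic y x (r : R) : 0 < r -> edist x y < r ->
  (kernel3 y x <=
    \sum_(0 <= k <oo) (2 ^+ k.+1 / r * \1_(eball3 y (r / 2 ^+ k)) x)%:E)%E.
Proof.
move=> r0 xyr.
pose u k : \bar R := (2 ^+ k.+1 / r * \1_(eball3 y (r / 2 ^+ k)) x)%:E.
rewrite -[leRHS]/(\sum_(0 <= k <oo) u k)%E.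
have u0 k : (0 <= u k)%E.
  by rewrite /u lee_fin mulr_ge0// divr_ge0// ?exprn_ge0// ltW.
have uS k : edist x y < r / 2 ^+ k -> ((2 ^+ k.+1 / r)%:E <= \sum_(0 <= k <oo) u k)%E.
  move=> xyk; apply: (@le_trans _ _ (\sum_(0 <= i < k.+1) u i)%E); last first.
    exact: nneseries_lim_ge.
  rewrite big_nat_recr//= -[leLHS]add0e leeD//; first exact: sume_ge0.
  by rewrite /u indicE mem_set// mulr1.
rewrite kernel3E; have [xy0|xy0] := eqVneq.
  rewrite leye_eq; apply/eqP/eqyP => M M0.
  apply: (@le_trans _ _ (2 ^+ (Num.truncn (M * r)).+1 / r)%:E); last first.
    by apply: uS; rewrite xy0 divr_gt0// exprn_gt0.
  rewrite lee_fin ler_pdivlMr// (le_trans (ltW (truncnS_gt _)))//.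
  by rewrite -natrX ler_nat ltnW// ltn_expl.
have xy_gt0 : 0 < edist x y by rewrite lt_neqAle eq_sym xy0 edist3_ge0.
have [k kP] : exists k, r / 2 ^+ k.+1 <= edist x y.
  exists (Num.truncn (r / edist x y)).
  rewrite ler_pdivrMr ?exprn_gt0// mulrC -ler_pdivrMr//.
  rewrite (le_trans (ltW (truncnS_gt _)))//.
  by rewrite -natrX ler_nat ltnW// ltn_expl.
(* By minimality [|x - y| < r / 2^m] (for [m = 0] this is the hypothesis), so the term of index [m]
   is active; its coefficient [2^(m+1) / r] is at least [1 / |x - y|]. *)
have [m mP m_min] := ex_minnP (ex_intro (fun k => r / 2 ^+ k.+1 <= edist x y) k kP).
apply: (@le_trans _ _ (2 ^+ m.+1 / r)%:E).
  by rewrite lee_fin -invf_div lef_pV2// ?posrE// divr_gt0// exprn_gt0.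
apply: uS; case: m mP m_min => [|m] mP m_min; first by rewrite expr0 divr1.
by rewrite ltNge; apply/negP => /m_min; rewrite ltnn.
Qed.

(** The dyadic bound on the kernel is integrated term by term. The ball of index [k] lies in a cube
    of side [2 r / 2^k], so its term is at most [16 r^2 / 4^k]. The constant is not sharp; what
    matters is that the bound tends to 0 with [r], uniformly in [y]. *)
Lemma kato_integral1_near y (r : R) : 0 < r ->
  (kato_integral (fun=> 1%R) (eball3 y r) y <= (32 * r ^+ 2)%:E)%E.
Proof.
move=> r0.
have mu_ k : measurable_fun setT
    (fun x : borelR3 R => (2 ^+ k.+1 / r * \1_(eball3 y (r / 2 ^+ k)) x)%:E).
  apply/measurable_EFinP; apply: measurable_funM => //.
  by apply: measurable_indic; exact: measurable_eball3.
have ge0 k (x : borelR3 R) : (0 <= (2 ^+ k.+1 / r * \1_(eball3 y (r / 2 ^+ k)) x)%:E)%E.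
  by rewrite lee_fin mulr_ge0// divr_ge0// ?exprn_ge0// ltW.
apply: (@le_trans _ _ (\int[mu]_x
  \sum_(0 <= k <oo) (2 ^+ k.+1 / r * \1_(eball3 y (r / 2 ^+ k)) x)%:E))%E.
  apply: (@le_trans _ _ (\int[mu]_(x in eball3 y r)
    \sum_(0 <= k <oo) (2 ^+ k.+1 / r * \1_(eball3 y (r / 2 ^+ k)) x)%:E))%E.
    apply: ge0_le_integral => //.
    - exact: measurable_eball3.
    - by move=> x _; exact: (kato_integrand_ge0 (fun=> 1%R)).
    - apply: measurable_funTS; apply: (measurable_kato_integrand (f := fun=> 1%R)).
      exact: measurable_cst.
    - by apply: measurable_funTS; apply: ge0_emeasurable_sum.
    - by move=> x xy; rewrite normr1 mul1e kernel3_le_dyadic.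
  apply: ge0_subset_integral => //.
  - exact: measurable_eball3.
  - by apply: ge0_emeasurable_sum.
  - by move=> x _; apply: nneseries_ge0.
rewrite integral_nneseries//.
(* The terms are compared with [32 r^2 / 2^(k+1)], whose sum is at most [32 r^2]. *)
apply: le_trans (epsilon_trick0 xpredT (_ : 0 <= 32 * r ^+ 2)); last first.
  by rewrite mulr_ge0// sqr_ge0.
apply: lee_nneseries => [k _ _|k _]; first exact: integral_ge0.
under eq_integral do rewrite EFinM.
rewrite ge0_integralZl//; last 2 first.
  by apply/measurable_EFinP; apply: measurable_indic; exact: measurable_eball3.
  by rewrite lee_fin divr_ge0// ?exprn_ge0// ltW.
have mB := @measurable_eball3 y (r / 2 ^+ k).
rewrite integral_indic// setIT.
apply: (@le_trans _ _ ((2 ^+ k.+1 / r)%:E * ((2 * (r / 2 ^+ k)) ^+ 3)%:E)%E).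
  rewrite lee_wpmul2l ?lee_fin ?divr_ge0 ?exprn_ge0 ?(ltW r0)//.
  rewrite -(leb3_ball y) ?divr_ge0 ?exprn_ge0 ?(ltW r0)//.
  by rewrite le_measure ?inE//; [exact: measurable_ball3|exact: eball3_ball].
rewrite -EFinM lee_fin natrX.
set t : R := 2 ^+ k; have t1 : 1 <= t by rewrite exprn_ege1// ler1n.
have t0 : t != 0 by rewrite gt_eqF// (lt_le_trans ltr01).
have -> : 2 ^+ k.+1 = 2 * t :> R by rewrite exprS.
have -> : 2 * t / r * (2 * (r / t)) ^+ 3 = 16 * r ^+ 2 / t / t by field; rewrite t0 gt_eqF.
have -> : 32 * r ^+ 2 / (2 * t) = 16 * r ^+ 2 / t by field.
rewrite ler_pdivrMr ?(lt_le_trans ltr01)// ler_peMr//.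
apply: divr_ge0; last exact: le_trans ler01 t1.
by rewrite mulr_ge0// sqr_ge0.
Qed.

End kato_integral.

(** * Smooth functions built from exp (- 1 / t) *)

Section flat.
Variable R : realType.
Implicit Types (t : R) (k : nat).

(** Differentiating [exp (- 1 / t)] produces powers of [1 / t]; the index [k] makes the span of the
    family stable under differentiation. *)
Definition flat k t : R := if 0 < t then t^-1 ^+ k * expR (- t^-1) else 0.

Lemma flat_ge0 k t : 0 <= flat k t.
Proof.
rewrite /flat; case: ifPn => // t0.
by rewrite mulr_ge0 ?expR_ge0// exprn_ge0// invr_ge0 ltW.
Qed.

(** With [s = 1 / t], the exponential series gives [exp s >= s^(k+2) / (k+2)!]. The order 2 in [t]
    is what makes the derivative at 0 vanish. *)
Lemma flat_le_sqr k t : flat k t <= k.+2`!%:R * t ^+ 2.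
Proof.
rewrite /flat; case: ifPn => t0; last by rewrite mulr_ge0// sqr_ge0.
have s0 : 0 < t^-1 by rewrite invr_gt0.
rewrite expRN ler_pdivrMr ?expR_gt0//.
have := expR_ge1Dxn k.+1 (ltW s0).
have f0 : 0 < k.+2`!%:R :> R by rewrite ltr0n fact_gt0.
rewrite -lerBrDl => /le_trans h.
have {}h : t^-1 ^+ k.+2 <= k.+2`!%:R * expR t^-1.
  by rewrite -ler_pdivrMl// mulrC h// gerBl.
have -> : t^-1 ^+ k = t^-1 ^+ k.+2 * t ^+ 2.
  by rewrite !exprS; field; rewrite gt_eqF.
by rewrite [leRHS]mulrAC ler_wpM2r// sqr_ge0.
Qed.

Lemma is_derive_flat k t :
  is_derive t 1 (flat k) (flat k.+2 t - k%:R * flat k.+1 t).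
Proof.
have [t0|t0|->] := ltgtP t 0.
- rewrite /flat (ltNge 0 t) (ltW t0)/= mulr0 subr0.
  apply: (near_eq_is_derive (f := cst 0)).
  near=> u; rewrite ltNge ltW//=; near: u; exact: lt_nbhsl.
- apply: (near_eq_is_derive (f := fun u : R => u^-1 ^+ k * expR (- u^-1))).
    near=> u; rewrite /flat ifT//; near: u; exact: lt_nbhsr.
  have dV : is_derive t 1 (fun u : R => u^-1) (- t ^- 2).
    have := @is_deriveV R id t 1 1 _ _.
    by rewrite gt_eqF// => /(_ isT (is_derive_id _ _)); rewrite /GRing.scale/= mulr1.
  have dX : is_derive t 1 (fun u : R => u^-1 ^+ k) (k%:R * t^-1 ^+ k.-1 * - t ^- 2).
    by have := is_deriveX k dV; rewrite exprfctE.
  have dE : is_derive t 1 (fun u : R => expR (- u^-1)) (expR (- t^-1) * t ^- 2).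
    have dN : is_derive t 1 (fun u : R => - u^-1) (t ^- 2).
      by rewrite -[t ^- 2]opprK; exact: is_deriveN.
    exact: is_derive1_comp.
  rewrite /flat t0.
  apply: (is_derive_eq (is_deriveM dX dE)).
  rewrite /GRing.scale/=; case: k {dX} => [|k]; rewrite ?exprS; field; rewrite gt_eqF//.
(* At 0 the claimed derivative is 0, and by [flat_le_sqr] the difference quotient is at most
   [(k+2)! |h|] in absolute value. *)
- rewrite /flat ltxx mulr0 subr0.
  have h : (fun h => h^-1 *: ((flat k \o shift 0) (h *: 1) - flat k 0)) @ 0^' --> (0 : R).
    have F0 : flat k 0 = 0 by rewrite /flat ltxx.
    apply/cvgr0Pnorm_le => e e0; near=> h.
    have h0 : h != 0 by near: h; exact: nbhs_dnbhs_neq.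
    rewrite /= F0 subr0 addr0 normrM normrV ?unitfE// [h *: 1]mulr1.
    rewrite (ger0_norm (flat_ge0 _ _)) ler_pdivrMl ?normr_gt0//.
    rewrite (le_trans (flat_le_sqr _ _))// -real_normK ?num_real// expr2 mulrCA.
    rewrite ler_wpM2l//.
    rewrite -ler_pdivlMl ?ltr0n ?fact_gt0//.
    near: h; apply: dnbhs0_le; rewrite mulr_gt0// invr_gt0 ltr0n fact_gt0//.
  apply: DeriveDef; first by apply/cvg_ex; exists 0.
  exact: cvg_lim h.
Unshelve. all: by end_near. Qed.

Lemma continuous_flat k : continuous (flat k).
Proof.
move=> t; apply/differentiable_continuous/derivable1_diffP.
by have := is_derive_flat k t => -[].
Qed.

End flat.

(* Closed under directional derivatives, hence made of smooth functions. *)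
Inductive flat_algebra (R : realType) : (R3 R -> R) -> Prop :=
| flat_algebra_affine k (a b c d : R) :
    flat_algebra (fun x => flat k (a * x.1.1 + b * x.1.2 + c * x.2 + d))
| flat_algebra_cst (c : R) : flat_algebra (fun=> c)
| flat_algebraD f g : flat_algebra f -> flat_algebra g -> flat_algebra (f + g)
| flat_algebraM f g : flat_algebra f -> flat_algebra g -> flat_algebra (f * g).

Section flat_algebra.
Variable R : realType.
Implicit Types (f g : R3 R -> R).

Lemma continuous_flat_algebra f : flat_algebra f -> continuous f.
Proof.
elim => [k a b c d|c|{}f g _ cf _ cg|{}f g _ cf _ cg] x.
- apply: (@continuous_comp _ _ _ (fun x : R3 R => a * x.1.1 + b * x.1.2 + c * x.2 + d) (flat k));
    last exact: continuous_flat.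
  have c11 : {for x, continuous (fun x : R3 R => x.1.1)}.
    by apply: continuous_comp; [exact: cvg_fst|exact: cvg_fst].
  have c12 : {for x, continuous (fun x : R3 R => x.1.2)}.
    by apply: continuous_comp; [exact: cvg_fst|exact: cvg_snd].
  have c2 : {for x, continuous (fun x : R3 R => x.2)} by exact: cvg_snd.
  apply: cvgD; last exact: cvg_cst.
  by apply: cvgD; [apply: cvgD|]; apply: cvgM; rewrite //; exact: cvg_cst.
- exact: cvg_cst.
- by apply: continuousD; [exact: cf|exact: cg].
- by apply: continuousM; [exact: cf|exact: cg].
Qed.

(** The chain rule gives the derivative of a generator, as [l v] times the combination in
    [is_derive_flat]; sums and products follow by the usual rules. Since the derivative is again in
    the algebra, the lemma can be iterated. *)
Lemma flat_algebra_derive f (v : R3 R) : flat_algebra f ->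
  exists2 g, flat_algebra g & forall x, is_derive x v f (g x).
Proof.
elim => [k a b c d|c|{}f g Ef [f' Ef' df] Eg [g' Eg' dg]|{}f g Ef [f' Ef' df] Eg [g' Eg' dg]].
- pose l (x : R3 R) := a * x.1.1 + b * x.1.2 + c * x.2.
  exists ((fun=> l v) * ((fun x => flat k.+2 (l x + d)) +
      (fun=> - k%:R) * (fun x => flat k.+1 (l x + d)))).
    apply: flat_algebraM; first exact: flat_algebra_cst.
    apply: flat_algebraD; first exact: flat_algebra_affine.
    by apply: flat_algebraM; [exact: flat_algebra_cst|exact: flat_algebra_affine].
  move=> x.
  have dl : is_derive (0 : R) 1 (fun h : R => h * l v + (l x + d)) (l v).
    have -> : (fun h : R => h * l v + (l x + d)) = (fun h => h *: l v) + cst (l x + d) by [].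
    rewrite -[X in is_derive _ _ _ X]addr0; apply: is_deriveD.
    have -> : (fun h : R => h *: l v) = (fun h => h * (cst (l v) h)) by [].
    have := @is_deriveM R R id (cst (l v)) 0 1 _ _ (is_derive_id _ _) (is_derive_cst _ _ _).
    by rewrite /GRing.scale/= mul0r add0r mulr1.
  have := @is_derive1_comp R (flat k) _ 0 _ _ (is_derive_flat k _) dl.
  rewrite mul0r add0r => -[dk vk].
  have lE (h : R) : l (h *: v + x) + d = h * l v + (l x + d).
    by rewrite /l/= /GRing.scale/=; ring.
  have fE : (fun h : R => flat k (l (h *: v + x) + d)) =
      flat k \o (fun h : R => h * l v + (l x + d)).
    by apply/funext => h /=; rewrite lE.
  have df : derivable (fun y : R3 R => flat k (l y + d)) x v.
    by apply/derivable1P; rewrite fE.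
  apply: DeriveDef => //.
  (* The derivative along [v] is that of a function of one variable on the line through [x]. *)
  transitivity ('D_1 (fun h : R => flat k (l (h *: v + x) + d)) 0).
    rewrite /derive; set g1 := fun h => h^-1 *: _; set g2 := fun h => h^-1 *: _.
    suff -> : g1 = g2 by [].
    by apply/funext => h; rewrite /g1 /g2 /= addr0 scale0r add0r [_%:A]mulr1.
  rewrite fE vk mulrC; congr (_ * _).
  by rewrite -mulNr.
- by exists (fun=> 0); [exact: flat_algebra_cst|move=> x; exact: is_derive_cst].
- by exists (f' + g'); [exact: flat_algebraD|move=> x; apply: is_deriveD].
- exists (f * g' + g * f'); last by move=> x; apply: is_deriveM.
  by apply: flat_algebraD; exact: flat_algebraM.
Qed.

Lemma flat_algebra_smooth f : flat_algebra f -> smooth f.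
Proof.
move=> Ef s.
have Es : flat_algebra (foldr (@partial R) f s).
  elim: s => //= i s Es; have [g Eg dg] := flat_algebra_derive (basis3 R i) Es.
  rewrite (_ : partial _ _ = g)//; apply/funext => x.
  exact: (@derive_val _ _ _ _ _ _ _ (dg x)).
split; first exact: continuous_flat_algebra.
move=> i x; have [g Eg dg] := flat_algebra_derive (basis3 R i) Es.
exact: (@ex_derive _ _ _ _ _ _ _ (dg x)).
Qed.

End flat_algebra.

(** * Approximation in Kato norm by test functions *)

Section cvge0.
Context {R : realType} {T : Type} {F : set_system T} {FF : Filter F}.
Implicit Type f : T -> \bar R.

Lemma cvge0_lt f : f @ F --> 0%E -> forall e : R, 0 < e -> \forall x \near F, (f x < e%:E)%E.
Proof.
move=> f0 e e0; apply: (f0 [set z | (z < e%:E)%E]).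
exact: (@nbhs_open_ereal_lt _ _ (fun=> e)).
Qed.

Lemma ge0_cvge0 f : (forall x, 0 <= f x)%E ->
  (forall e : R, 0 < e -> \forall x \near F, (f x <= e%:E)%E) -> f @ F --> 0%E.
Proof.
move=> f0 fe A /= [e /= e0 eA].
have e20 : 0 < e / 2 by rewrite divr_gt0.
apply: filterS (fe _ e20) => x fx.
have xfin : f x \is a fin_num by rewrite ge0_fin_numE// (le_lt_trans fx)// ltry.
rewrite /= -(fineK xfin); apply: eA.
have := f0 x; rewrite /= sub0r normrN -(fineK xfin) lee_fin => ?.
rewrite ger0_norm//; move: fx; rewrite -(fineK xfin) lee_fin => /le_lt_trans; apply.
by rewrite ltr_pdivrMr// ltr_pMr// ltr1n.
Qed.

End cvge0.

Section test_function.
Variable R : realType.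
Implicit Types (f g phi : R3 R -> R) (x y : R3 R).

(** A subclass of [Ccinfty] that is stable under sums and multiples by construction, so that
    smoothness is proved only once, for the algebra. *)
Definition test_function phi := flat_algebra phi /\
  exists n, forall x, phi x != 0 -> ball (0 : R3 R) n.+1%:R x.

Lemma test_function_Ccinfty phi : test_function phi -> Ccinfty phi.
Proof.
move=> [Ephi [n phin]]; split; first exact: flat_algebra_smooth.
have cK := @compact_cube3 R n.+1%:R.
have clK : closed ((`[- n.+1%:R, n.+1%:R] `*` `[- n.+1%:R, n.+1%:R]) `*`
    `[- n.+1%:R, n.+1%:R] : set (R3 R)).
  exact: compact_closed (@norm_hausdorff _ _) cK.
apply: (subclosed_compact _ cK); first exact: closed_closure.
rewrite closureE => x; apply; split => // z /phin.
exact: ball3_subset_cube3.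
Qed.

Lemma measurable_test_function phi : test_function phi ->
  measurable_fun setT (phi : borelR3 R -> R).
Proof. by move=> [/continuous_flat_algebra/continuous_measurable3]. Qed.

Lemma test_functionD f g : test_function f -> test_function g -> test_function (f + g).
Proof.
move=> [Ef [n fn]] [Eg [m gm]]; split; first exact: flat_algebraD.
exists (maxn n m) => x fg0; have [fx0|fx0] := eqVneq (f x) 0.
- have /gm : g x != 0 by apply: contraNneq fg0 => gx0; rewrite /GRing.add/= fx0 gx0 addr0.
  by apply: le_ball; rewrite ler_nat ltnS leq_maxr.
- by move: (fn _ fx0); apply: le_ball; rewrite ler_nat ltnS leq_maxl.
Qed.

Lemma test_functionZ (c : R) f : test_function f -> test_function ((fun=> c) * f).
Proof.
move=> [Ef [n fn]]; split; first by apply: flat_algebraM => //; exact: flat_algebra_cst.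
exists n => x cfx; apply: fn; apply: contraNneq cfx => fx0.
by rewrite /GRing.mul/= fx0 mulr0.
Qed.

End test_function.

(** * Dominated convergence and approximation in Kato norm *)

Section kato_approx.
Variable R : realType.
Implicit Types (f g phi : R3 R -> R) (x y : R3 R) (Q : set (borelR3 R)).
Local Notation mu := (leb3 R).

(** The local Kato property of [f dx] in epsilon form, with one radius for all centres. *)
Definition uniform_kato f := forall e : R, 0 < e -> exists2 r : R, 0 < r &
  forall y, (kato_integral f (eball3 y r) y <= e%:E)%E.

Lemma le_uniform_kato f g : measurable_fun setT (f : borelR3 R -> R) ->
  measurable_fun setT (g : borelR3 R -> R) -> (forall x, `|f x| <= `|g x|) ->
  uniform_kato g -> uniform_kato f.
Proof.
move=> mf mg fg gK e /gK[r r0 gr]; exists r => // y.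
by apply: le_trans (gr y); apply: le_kato_integral => //; exact: measurable_eball3.
Qed.

Lemma uniform_kato1 : uniform_kato (fun=> 1).
Proof.
(* This radius solves [32 r^2 = e], the bound of [kato_integral1_near]. *)
move=> e e0; exists (Num.sqrt (e / 32)); first by rewrite sqrtr_gt0 divr_gt0.
move=> y; rewrite (le_trans (kato_integral1_near _ _)) ?sqrtr_gt0 ?divr_gt0//.
have e1 : 0 <= e / 32 by rewrite divr_ge0// ltW.
by rewrite lee_fin sqr_sqrtr// mulrC divfK.
Qed.

(** Within [r] of [y], domination by [F] makes the integral at most [e / 2] for every [n]. Farther
    away the kernel is at most [1 / r], and the integrals of [|g n|] tend to 0 by dominated
    convergence. Neither [r] nor [n] depends on [y], hence the uniformity. *)
Lemma kato_integral_dominated_cvg0 Q (F : R3 R -> R) (g : (R3 R -> R)^nat) :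
    measurable Q -> measurable_fun setT (F : borelR3 R -> R) ->
    (forall n, measurable_fun setT (g n : borelR3 R -> R)) ->
    uniform_kato F -> mu.-integrable Q (EFin \o F) ->
    (forall n x, `|g n x| <= `|F x|) -> (forall n x, ~ Q x -> g n x = 0) ->
    (forall x, g n x @[n --> \oo] --> 0) ->
  forall e : R, 0 < e -> exists n, forall y, (kato_integral (g n) setT y <= e%:E)%E.
Proof.
move=> mQ mF mg uF iF gF gQ g0 e e0.
have e20 : 0 < e / 2 by rewrite divr_gt0.
have [r r0 Fr] := uF _ e20.
(* The factor [r] offsets the bound [1 / r] of the kernel away from [y]. *)
have [n gn] : exists n, (\int[mu]_(x in Q) `|g n x|%:E <= (r * (e / 2))%:E)%E.
  have [|//|||| _ ig0 _] := @dominated_convergence _ _ _ mu Q mQ (fun n => EFin \o g n)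
    (cst 0%E) (fun x => `|F x|%:E).
  - by move=> n; apply: measurable_funTS; exact/measurable_EFinP.
  - by apply: aeW => x _; apply: cvg_EFin; [exact: nearW|exact: g0].
  - exact: integrable_abse iF.
  - by apply: aeW => x n _; rewrite /= lee_fin.
  have re : 0 < r * (e / 2) by rewrite mulr_gt0.
  have [n _ /(_ n (leqnn n))] := cvge0_lt ig0 re.
  rewrite /= => gn; exists n; apply/ltW; apply: le_lt_trans gn.
  rewrite le_eqVlt; apply/orP; left; apply/eqP; apply: eq_integral => x _.
  by rewrite subr0.
exists n => y; rewrite (kato_integral_setD y (mg n) (@measurable_eball3 R y r) measurableT).
rewrite [e]splitr EFinD setTI leeD//.
  apply: le_trans (Fr y); apply: le_kato_integral => //; exact: measurable_eball3.
have mD : measurable (~` eball3 y r) by apply: measurableC; exact: measurable_eball3.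
rewrite setTD; apply: (le_trans (kato_integral_far _ mD r0 _)) => //.
  by move=> x xr; rewrite leNgt; exact/negP.
rewrite EFinM in gn.
rewrite muleC lee_pdivrMr// muleC (le_trans _ gn)//.
have mng : measurable_fun setT (fun x : borelR3 R => `|g n x|%:E).
  by apply/measurable_EFinP; exact: measurableT_comp.
apply: (@le_trans _ _ (\int[mu]_x `|g n x|%:E)%E).
  by apply: ge0_subset_integral.
rewrite [in leRHS]integral_mkcond; apply: ge0_le_integral => //.
- by rewrite -(measurable_restrictT _ mQ); exact: measurable_funTS.
- move=> x _; rewrite patchE; case: ifPn => //.
  by rewrite notin_setE => /gQ ->; rewrite normr0.
Qed.

Definition kato_approx f := measurable_fun setT (f : borelR3 R -> R) /\
  forall e : R, 0 < e -> exists2 phi, test_function phi &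
    forall y, (kato_integral (fun x => f x - phi x)%R setT y <= e%:E)%E.

Lemma kato_approx_lim f : measurable_fun setT (f : borelR3 R -> R) ->
  (forall e : R, 0 < e -> exists2 g, kato_approx g &
    forall y, (kato_integral (fun x => f x - g x)%R setT y <= e%:E)%E) ->
  kato_approx f.
Proof.
move=> mf fg; split=> // e e0; have e20 : 0 < e / 2 by rewrite divr_gt0.
have [g [mg /(_ _ e20)[phi tphi gphi]] fge] := fg _ e20.
have mphi := measurable_test_function tphi.
exists phi => // y; rewrite [e]splitr EFinD.
apply: le_trans (leeD (fge y) (gphi y)).
apply: le_kato_integralD => //; try exact: measurable_funB.
move=> x _; exact: ler_distD.
Qed.

Lemma kato_approxD f g : kato_approx f -> kato_approx g ->
  kato_approx (fun x => f x + g x).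
Proof.
move=> [mf fK] [mg gK]; split; first exact: measurable_funD.
move=> e e0; have e20 : 0 < e / 2 by rewrite divr_gt0.
have [phi tphi fphi] := fK _ e20; have [psi tpsi gpsi] := gK _ e20.
have mphi := measurable_test_function tphi.
have mpsi := measurable_test_function tpsi.
exists (phi + psi); first exact: test_functionD.
move=> y; rewrite [e]splitr EFinD.
apply: le_trans (leeD (fphi y) (gpsi y)).
apply: le_kato_integralD => //; do ?[exact: measurable_funB].
  by apply: measurable_funB; exact: measurable_funD.
by move=> x _; rewrite opprD addrACA ler_normD.
Qed.

Lemma kato_approxZ (c : R) f : kato_approx f -> kato_approx (fun x => c * f x).
Proof.
move=> [mf fK]; split; first exact: measurable_funM.
(* Dividing by [|c| + 1] instead of [|c|] covers [c = 0]. *)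
move=> e e0; have c1 : 0 < `|c| + 1 by rewrite ltr_wpDl.
have [|phi tphi fphi] := fK (e / (`|c| + 1)); first by rewrite divr_gt0.
have mphi := measurable_test_function tphi.
exists ((fun=> c) * phi); first exact: test_functionZ.
move=> y; have -> : (fun x => c * f x - ((fun=> c) * phi) x) = (fun x => c * (f x - phi x)).
  by apply/funext => x; rewrite mulrBr.
rewrite kato_integralZ//; last exact: measurable_funB.
apply: (@le_trans _ _ (`|c|%:E * (e / (`|c| + 1))%:E)%E); first by rewrite lee_wpmul2l.
by rewrite -EFinM lee_fin mulrCA ger_pMr// ler_pdivrMr// mul1r lerDl.
Qed.

End kato_approx.

(** * Boxes and smooth bumps *)

Section box3.
Variable R : realType.
Implicit Types (a b x : R3 R).
Local Notation mu := (leb3 R).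

Definition box3 a b : set (borelR3 R) :=
  (`]a.1.1, b.1.1[ `*` `]a.1.2, b.1.2[) `*` `]a.2, b.2[.

Lemma measurable_box3 a b : measurable (box3 a b).
Proof. by apply: measurableX; [apply: measurableX|]; exact: measurable_itv. Qed.

Lemma bounded_box3 a b : bounded_set (box3 a b : set (R3 R)).
Proof.
apply: bounded_subset (ball3_bounded 0 (`|a| + `|b| + 1)) => x [[]].
rewrite /= !in_itv/= => /andP[a1 b1] /andP[a2 b2] /andP[a3 b3].
have coord (z : R3 R) : [/\ `|z.1.1| <= `|z|, `|z.1.2| <= `|z| & `|z.2| <= `|z|].
  rewrite !prod_normE; split; rewrite ?le_max ?lexx ?orbT//.
have [na1 na2 na3] := coord a; have [nb1 nb2 nb3] := coord b.
apply/ball3_coordP; rewrite !subr0 !ltr_norml; split; apply/andP; split.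
all: move: na1 na2 na3 nb1 nb2 nb3; rewrite !ler_norml.
all: move=> /andP[? ?] /andP[? ?] /andP[? ?] /andP[? ?] /andP[? ?] /andP[? ?].
all: lra.
Qed.

Lemma leb3_bounded_lty (A : set (borelR3 R)) : measurable A ->
  bounded_set (A : set (R3 R)) -> (mu A < +oo)%E.
Proof.
move=> mA /bounded_set_ball3[n An].
apply: (@le_lt_trans _ _ (mu (ball (0 : R3 R) n.+1%:R))).
  by apply: le_measure; rewrite ?inE//; exact: measurable_ball3.
by rewrite leb3_ball// ltry.
Qed.

(* Positive on (a, b), and tending to 1 there as n grows. *)
Definition bump (n : nat) (a b t : R) : R :=
  flat 0 (n.+1%:R * (t - a)) * flat 0 (n.+1%:R * (b - t)).

Lemma flat0_le1 (t : R) : flat 0 t <= 1.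
Proof.
rewrite /flat; case: ifPn => // t0.
by rewrite expr0 mul1r expR_le1 oppr_le0 invr_ge0 ltW.
Qed.

Lemma bump_ge0 n (a b t : R) : 0 <= bump n a b t.
Proof. by rewrite mulr_ge0// flat_ge0. Qed.

Lemma bump_le1 n (a b t : R) : bump n a b t <= 1.
Proof. by rewrite mulr_ile1 ?flat_ge0 ?flat0_le1. Qed.

Lemma bump_out n (a b t : R) : t \notin `]a, b[ -> bump n a b t = 0.
Proof.
rewrite in_itv/= negb_and -!leNgt => /orP[ta|bt]; rewrite /bump /flat.
  by rewrite ltNge pmulr_rle0// subr_le0 ta/= mul0r.
by rewrite [X in _ * X]ifN ?mulr0// -leNgt pmulr_rle0// subr_le0.
Qed.

Lemma cvg_flat0 (s : R) : 0 < s -> flat 0 (n.+1%:R * s) @[n --> \oo] --> (1 : R).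
Proof.
move=> s0.
have -> : (fun n => flat 0 (n.+1%:R * s)) = (fun n => expR (- (s^-1 * n.+1%:R^-1))).
  by apply/funext => n; rewrite /flat mulr_gt0// expr0 mul1r invfM mulrC.
rewrite -[X in _ --> X]expR0; apply: continuous_cvg; first exact: continuous_expR.
rewrite -oppr0; apply: cvgN; rewrite -(mulr0 s^-1); apply: cvgM; first exact: cvg_cst.
exact: cvg_harmonic.
Qed.

Lemma cvg_bump (a b t : R) : bump n a b t @[n --> \oo] --> (\1_(`]a, b[ : set R) t : R).
Proof.
rewrite indicE; have [|tab] := boolP (t \in _).
  rewrite inE /= in_itv/= => /andP[at_ tb].
  by rewrite -[X in _ --> X]mulr1; apply: cvgM; apply: cvg_flat0; rewrite subr_gt0.
have -> : (fun n => bump n a b t) = fun=> 0.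
  by apply/funext => n; apply: bump_out; move: tab; rewrite notin_setE => /negP.
exact: cvg_cst.
Qed.

(** Products of one-dimensional bumps vanish off the box, take values in [[0, 1]] and converge
    pointwise to the indicator, including on the faces because the box is open. The constant 1
    dominates the differences. *)
Lemma kato_approx_box a b : kato_approx (\1_(box3 a b) : R3 R -> R).
Proof.
pose phi n : R3 R -> R := fun x =>
  bump n a.1.1 b.1.1 x.1.1 * bump n a.1.2 b.1.2 x.1.2 * bump n a.2 b.2 x.2.
have mB := measurable_box3 a b.
have m1 : measurable_fun setT (\1_(box3 a b) : borelR3 R -> R) by exact: measurable_indic.
split => // e e0.
have phi_out n x : ~ box3 a b x -> phi n x = 0.
  move=> /not_andP[/not_andP[|]|] /negP h; rewrite /phi (bump_out _ h).
  - by rewrite !mul0r.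
  - by rewrite mulr0 mul0r.
  - by rewrite mulr0.
have Eflat n k1 k2 k3 d : flat_algebra (fun x : R3 R =>
    flat 0 (n.+1%:R * (k1 * x.1.1 + k2 * x.1.2 + k3 * x.2 + d))).
  rewrite (_ : (fun x => _) = (fun x => flat 0 ((n.+1%:R * k1) * x.1.1 + (n.+1%:R * k2) * x.1.2
    + (n.+1%:R * k3) * x.2 + n.+1%:R * d))); first exact: flat_algebra_affine.
  by apply/funext => x; rewrite !mulrDr !mulrA.
have tphi n : test_function (phi n).
  split.
    (* Each of the six one-dimensional factors is [flat 0] of an affine form on the whole space,
       hence a generator of the algebra. *)
    have -> : phi n =
      ((fun x => flat 0 (n.+1%:R * (1 * x.1.1 + 0 * x.1.2 + 0 * x.2 + - a.1.1))) *
       (fun x => flat 0 (n.+1%:R * (-1 * x.1.1 + 0 * x.1.2 + 0 * x.2 + b.1.1)))) *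
      ((fun x => flat 0 (n.+1%:R * (0 * x.1.1 + 1 * x.1.2 + 0 * x.2 + - a.1.2))) *
       (fun x => flat 0 (n.+1%:R * (0 * x.1.1 + -1 * x.1.2 + 0 * x.2 + b.1.2)))) *
      ((fun x => flat 0 (n.+1%:R * (0 * x.1.1 + 0 * x.1.2 + 1 * x.2 + - a.2))) *
       (fun x => flat 0 (n.+1%:R * (0 * x.1.1 + 0 * x.1.2 + -1 * x.2 + b.2)))).
      apply/funext => x; rewrite /phi /bump !mulrfctE.
      by congr (_ * _ * (_ * _) * (_ * _)); congr flat; congr (_ * _); ring.
    by do !apply: flat_algebraM.
  have [m hm] := bounded_set_ball3 (bounded_box3 a b).
  exists m => x phix; apply: hm; apply: contrapT => Bx.
  by move: phix; rewrite phi_out// eqxx.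
have mphi n := measurable_test_function (tphi n).
have phi01 n x : 0 <= phi n x <= 1.
  have M01 (p q : R) : 0 <= p <= 1 -> 0 <= q <= 1 -> 0 <= p * q <= 1.
    by move=> /andP[? ?] /andP[? ?]; rewrite mulr_ge0// mulr_ile1.
  by apply: (M01); [apply: (M01)|]; rewrite bump_ge0 bump_le1.
have [n hn] : exists n, forall y,
    (kato_integral (fun x => \1_(box3 a b) x - phi n x)%R setT y <= e%:E)%E.
  apply: (@kato_integral_dominated_cvg0 R (box3 a b) (fun=> 1)) => //.
  - by move=> n; exact: measurable_funB.
  - exact: uniform_kato1.
  - have iB := measurable_bounded_integrable mB (leb3_bounded_lty mB (bounded_box3 a b)).
    by apply: iB; [exact: measurable_cst|exact: bounded_cst].
  - move=> n x; rewrite normr1 indicE; have /andP[p0 p1] := phi01 n x.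
    by case: (_ \in _) => /=; rewrite ?sub0r ?normrN ger0_norm ?subr_ge0// lerBlDr lerDl.
  - by move=> n x Bx; rewrite phi_out// indicE memNset// subr0.
  - move=> x.
    have -> : \1_(box3 a b) x = \1_(`]a.1.1, b.1.1[ : set R) x.1.1 *
        \1_(`]a.1.2, b.1.2[ : set R) x.1.2 * \1_(`]a.2, b.2[ : set R) x.2 :> R.
      rewrite !indicE /box3 !in_setX.
      by case: (_ \in _); case: (_ \in _); case: (_ \in _); rewrite /= ?mul0r ?mulr0 ?mulr1.
    set l := _ * _ * _; rewrite -[X in _ --> X](subrr l); apply: cvgB; first exact: cvg_cst.
    by apply: cvgM; [apply: cvgM|]; exact: cvg_bump.
by exists (phi n).
Qed.

End box3.

(** * A generating pi-system of the Borel sets *)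

Section half_line_products.
Variable R : realType.

(** The whole line is included so that a condition on a single coordinate gives a product of this
    class. A half-line unbounded below meets an open interval in an open interval with the same left
    end, so these products cut boxes into boxes. *)
Definition half_line : set (set R) := [set I | I = setT \/ exists c : R, I = [set` `]-oo, c[]].

Definition half_line_products : set (set (borelR3 R)) :=
  [set A | exists I J K, [/\ half_line I, half_line J, half_line K & A = (I `*` J) `*` K]].

Lemma half_line_setI I J : half_line I -> half_line J -> half_line (I `&` J).
Proof.
move=> [->|[a ->]] [->|[b ->]]; rewrite ?setTI ?setIT;
  [by left|by right; exists b|by right; exists a|].
right; exists (Num.min a b); apply/seteqP; split => x /=; rewrite !in_itv/= lt_min.
  by move=> [-> ->].
by move=> /andP.
Qed.

Lemma half_line_products_setI : setI_closed half_line_products.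
Proof.
move=> _ _ [I [J [K [hI hJ hK ->]]]] [I' [J' [K' [hI' hJ' hK' ->]]]].
exists (I `&` I'), (J `&` J'), (K `&` K'); split; try exact: half_line_setI.
by rewrite -!setXI.
Qed.

(** The identity map from the generated sigma-algebra to [borelR3] is measurable because its three
    coordinates are: preimages of half-lines belong to the class. *)
Lemma measurable_half_line_products :
  @measurable _ (borelR3 R) `<=` <<s half_line_products >>.
Proof.
move=> A mA.
pose T := g_sigma_algebraType half_line_products.
have coord (p : T -> R) : (forall c, half_line_products (p @^-1` [set` `]-oo, c[])) ->
    measurable_fun setT (p : T -> measurableTypeR R).
  move=> pG; apply: (measurability _ (RGenInftyO.measurableE R)).
  by move=> _ [_ [c ->] <-]; rewrite setTI; apply: sub_sigma_algebra; exact: pG.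
have id_meas : measurable_fun setT ((fun x => (x.1.1, x.1.2, x.2)) : T -> borelR3 R).
  apply: measurable_fun_pair; first apply: measurable_fun_pair; apply: coord => c.
  - exists [set` `]-oo, c[], setT, setT; split; [by right; exists c|by left|by left|].
    by apply/seteqP; split => x //= [[]].
  - exists setT, [set` `]-oo, c[], setT; split; [by left|by right; exists c|by left|].
    by apply/seteqP; split => x //= [[]].
  - exists setT, setT, [set` `]-oo, c[]; split; [by left|by left|by right; exists c|].
    by apply/seteqP; split => x //= [[]].
have := id_meas measurableT A mA; rewrite setTI.
by rewrite (_ : _ @^-1` A = A)//; apply/seteqP; split => -[[]].
Qed.

End half_line_products.

(** * From boxes to Borel sets *)

Section kato_approx_density.
Variable R : realType.
Local Notation mu := (leb3 R).
Implicit Types (a b x y : R3 R) (f : R3 R -> R).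

(** Dynkin's argument: the sets [A] with this property form a lambda-system containing the half-line
    products. Intersecting with a fixed box keeps the constant 1 integrable where it serves as
    dominating function. *)
Lemma kato_approx_indic a b (A : set (borelR3 R)) : measurable A ->
  kato_approx (\1_(A `&` box3 a b) : R3 R -> R).
Proof.
move=> /measurable_half_line_products.
have mB := @measurable_box3 R a b.
suff : <<s @half_line_products R >> `<=`
    [set A | measurable A /\ kato_approx (\1_(A `&` box3 a b))].
  by move=> /[apply] -[].
apply: (@lambda_system_subset _ _ (@half_line_products_setI R) setT); last by [].
- split.
  + by [].
  + by split=> //; rewrite setTI; exact: kato_approx_box.
  (* For [Y] inside [X] the indicator of the difference is the difference of the indicators. *)
  + move=> X Y YX [mX kX] [mY kY]; split; first exact: measurableD.
    rewrite (_ : \1_ _ = (fun x => \1_(X `&` box3 a b) x +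
        (-1) * \1_(Y `&` box3 a b) x) :> (R3 R -> R)).
      by apply: kato_approxD => //; exact: kato_approxZ.
    apply/funext => x; rewrite !indicE; move: (box3 a b) => B; rewrite !in_setI in_setC.
    have XY : x \in Y -> x \in X by rewrite !inE; exact: YX.
    case: (x \in Y) XY => [/(_ isT) ->|_]; case: (x \in X); case: (x \in B);
      rewrite /= ?mulr0 ?mulr1 ?addr0 ?subrr ?mulN1r ?subrr //.
  + move=> F ndF FK; have mF n : measurable (F n) by have [] := FK n.
    have mUF : measurable (\bigcup_n F n) by exact: bigcupT_measurable.
    have m1 (X : set (borelR3 R)) : measurable X ->
      measurable_fun setT (\1_(X `&` box3 a b) : borelR3 R -> R).
      by move=> mX; apply: measurable_indic; exact: measurableI.
    split => //; apply: kato_approx_lim; first exact: m1.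
    move=> e e0.
    have [n hn] : exists n, forall y, (kato_integral (fun x =>
        \1_(\bigcup_n F n `&` box3 a b) x - \1_(F n `&` box3 a b) x)%R setT y <= e%:E)%E.
      apply: (@kato_integral_dominated_cvg0 R (box3 a b) (fun=> 1)) => //.
      * by move=> n; apply: measurable_funB; exact: m1.
      * exact: uniform_kato1.
      * apply: (measurable_bounded_integrable mB (leb3_bounded_lty mB (bounded_box3 a b))).
          exact: measurable_cst.
        exact: bounded_cst.
      * move=> n x; rewrite normr1 !indicE.
        by case: (_ \in _); case: (_ \in _); rewrite ?subrr ?subr0 ?sub0r ?normrN ?normr0 ?normr1.
      * by move=> n x Bx; rewrite !indicE !memNset ?subr0// => -[].
      (* At each point the sequence is eventually 0, since the sets [F n] increase to their
         union. *)
      * move=> x; apply: cvg_near_cst.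
        have [Ux|Ux] := pselect ((\bigcup_n F n) x); last first.
          near=> n; rewrite !indicE !memNset ?subr0//; first by move=> [Fx _]; apply: Ux; exists n.
          by case.
        have [m _ Fmx] := Ux.
        exists m => // n /= mn.
        have Fnx : F n x by move/subsetPset : (ndF _ _ mn); exact.
        rewrite !indicE; move: (box3 a b) => B.
        by rewrite !in_setI (mem_set Ux) (mem_set Fnx) subrr.
    by exists (\1_(F n `&` box3 a b)) => //; have [] := FK n.
- move=> _ [I [J [K [hI hJ hK ->]]]]; split.
    have mh L : half_line L -> measurable (L : set (measurableTypeR R)).
      by move=> [->|[c ->]]; [exact: measurableT|exact: measurable_itv].
    by apply: measurableX; [apply: measurableX|]; exact: mh.
  (* Only the upper corner of the box changes; an empty intersection is a degenerate box. *)
  have cut L (s t : R) : half_line L -> exists c, L `&` [set` `]s, t[] = [set` `]s, c[].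
    move=> [->|[c ->]]; first by exists t; rewrite setTI.
    exists (Num.min c t); apply/seteqP; split => z /=; rewrite !in_itv/= lt_min.
      by move=> [-> /andP[-> ->]].
    by move=> /and3P[-> -> ->].
  have [c1 h1] := cut _ a.1.1 b.1.1 hI.
  have [c2 h2] := cut _ a.1.2 b.1.2 hJ.
  have [c3 h3] := cut _ a.2 b.2 hK.
  rewrite /box3 -!setXI h1 h2 h3.
  exact: (@kato_approx_box R a (c1, c2, c3)).
Unshelve. all: by end_near. Qed.

End kato_approx_density.

(** * From simple functions to functions cut to a box *)

Section kato_approx_cut.
Variable R : realType.
Local Notation mu := (leb3 R).
Implicit Types (a b x y : R3 R) (f : R3 R -> R).
Import HBNNSimple.

Lemma kato_approx_nnsfun a b (h : {nnsfun borelR3 R >-> R}) :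
  kato_approx (fun x => h x * \1_(box3 a b) x).
Proof.
have mB := @measurable_box3 R a b.
have -> : (fun x : R3 R => h x * \1_(box3 a b) x) =
    (fun x => \sum_(r <- finmap.enum_fset (fset_set (range h)))
      r * \1_(h @^-1` [set r] `&` box3 a b) x).
  apply/funext => x; rewrite {1}(fimfunE h x) fsbig_finite//= mulr_suml.
  apply: eq_bigr => r _; rewrite -mulrA; congr (_ * _).
  by rewrite !indicE in_setI; case: (_ \in _); case: (_ \in _); rewrite /= ?mulr1 ?mulr0.
(* Induction on the list of values; the empty sum is written as 0 times an indicator. *)
elim: (finmap.enum_fset _) => [|r s IH].
  have -> : (fun x : R3 R => \sum_(r <- [::]) r * \1_(h @^-1` [set r] `&` box3 a b) x) =
      (fun x => 0 * \1_(setT `&` box3 a b) x).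
    by apply/funext => x; rewrite big_nil mul0r.
  by apply: kato_approxZ; exact: kato_approx_indic.
under eq_fun do rewrite big_cons.
apply: kato_approxD => //; apply: kato_approxZ; exact: kato_approx_indic.
Qed.

(** Simple functions increasing to [f] leave errors dominated by [f] itself. This is where the local
    Kato property of [f] and its integrability on the box are used, in place of those of the
    constant 1. *)
Lemma ge0_kato_approx_cut a b f : measurable_fun setT (f : borelR3 R -> R) ->
  (forall x, 0 <= f x) -> uniform_kato f -> mu.-integrable (box3 a b) (EFin \o f) ->
  kato_approx (fun x => f x * \1_(box3 a b) x).
Proof.
move=> mf f0 fK fi; have mB := @measurable_box3 R a b.
have mfB : measurable_fun setT (fun x : borelR3 R => f x * \1_(box3 a b) x).
  by apply: measurable_funM => //; exact: measurable_indic.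
apply: kato_approx_lim => // e e0.
have mEf : measurable_fun setT (EFin \o f : borelR3 R -> \bar R) by exact/measurable_EFinP.
pose h := nnsfun_approx measurableT mEf.
have hf n (x : borelR3 R) : h n x <= f x.
  by rewrite -lee_fin /h nnsfun_approxE; apply: le_approx => // z _; rewrite lee_fin.
have hcv (x : borelR3 R) : h n x @[n --> \oo] --> f x.
  have := @cvg_nnsfun_approx _ _ _ _ measurableT _ mEf (fun z _ => f0 z) x I.
  by move=> /fine_cvgP[].
have [n hn] : exists n, forall y, (kato_integral (fun x =>
    f x * \1_(box3 a b) x - h n x * \1_(box3 a b) x)%R setT y <= e%:E)%E.
  apply: (@kato_integral_dominated_cvg0 R (box3 a b) f) => //.
  - move=> n; apply: measurable_funB => //; apply: measurable_funM.
      exact: measurable_funP.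
    exact: measurable_indic.
  - move=> n x; rewrite -mulrBl indicE !ger0_norm//.
      by case: (_ \in _); rewrite ?mulr1 ?mulr0// gerBl.
    by rewrite mulr_ge0// subr_ge0 hf.
  - by move=> n x Bx; rewrite indicE memNset// !mulr0 subrr.
  - move=> x; rewrite -[X in _ --> X](subrr (f x * \1_(box3 a b) x)).
    by apply: cvgB; [exact: cvg_cst|apply: cvgM => //; exact: cvg_cst].
by exists (fun x => h n x * \1_(box3 a b) x) => //; exact: kato_approx_nnsfun.
Qed.

Lemma kato_approx_cut a b f : measurable_fun setT (f : borelR3 R -> R) ->
  uniform_kato f -> mu.-integrable (box3 a b) (EFin \o f) ->
  kato_approx (fun x => f x * \1_(box3 a b) x).
Proof.
move=> mf fK fi; have mB := @measurable_box3 R a b.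
have -> : (fun x => f x * \1_(box3 a b) x) = (fun x =>
    (f^\+)%R x * \1_(box3 a b) x + (-1) * ((f^\-)%R x * \1_(box3 a b) x)).
  by apply/funext => x; rewrite mulN1r -mulrBl -[in LHS](funrposBneg f).
have mp : measurable_fun setT ((f^\+)%R : borelR3 R -> R) by exact: measurable_funrpos.
have mn : measurable_fun setT ((f^\-)%R : borelR3 R -> R) by exact: measurable_funrneg.
have lep x : `|(f^\+)%R x| <= `|f x|.
  by rewrite ger0_norm ?funrpos_ge0// /funrpos ge_max ler_norm normr_ge0.
have len x : `|(f^\-)%R x| <= `|f x|.
  by rewrite ger0_norm ?funrneg_ge0// /funrneg ge_max -normrN ler_norm normr_ge0.
have iL g : measurable_fun setT (g : borelR3 R -> R) -> (forall x, `|g x| <= `|f x|) ->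
    mu.-integrable (box3 a b) (EFin \o g).
  move=> mg gf; apply: le_integrable fi => //.
    by apply/measurable_EFinP; exact: measurable_funTS.
  by move=> x _; rewrite /= lee_fin.
apply: kato_approxD; last apply: kato_approxZ; apply: ge0_kato_approx_cut => //.
- exact: le_uniform_kato lep fK.
- exact: iL.
- exact: le_uniform_kato len fK.
- exact: iL.
Qed.

End kato_approx_cut.

(** * Existence of a density *)

Section leb3_sigma_finite.
Variable R : realType.

(* An alias of leb3 that can carry a sigma-finite structure: the one of the product
   measure is not inferred through leb3. *)
Definition leb3_set_function : set (borelR3 R) -> \bar R := leb3 R.

HB.instance Definition _ := Measure.on leb3_set_function.

Let leb3_sigma_finite : sigma_finite setT leb3_set_function.
Proof.
exists (fun n => ball (0 : R3 R) n.+1%:R); first by rewrite bigcup_ball3.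
move=> n; have mB := @measurable_ball3 R 0 n.+1%:R.
by split => //; exact: leb3_bounded_lty mB (ball3_bounded _ _).
Qed.

HB.instance Definition _ := Measure_isSigmaFinite.Build _ _ _ leb3_set_function
  leb3_sigma_finite.

End leb3_sigma_finite.

Section restricted_charge.
Variable R : realType.
Variables (V : set (R3 R) -> R) (D : set (borelR3 R)).
Hypotheses (mD : measurable D) (bD : bounded_set (D : set (R3 R))) (mV : loc_measure V).
Local Notation mu := (leb3 R).

(** Since [D] is bounded, this is a finite signed measure defined on all Borel sets, to which the
    Radon-Nikodym theorem applies. *)
Definition restricted_charge (A : set (borelR3 R)) : \bar R := (V (A `&` D))%:E.

Let nu0 : restricted_charge set0 = 0%E.
Proof. by have [V0 _ _] := mV; rewrite /restricted_charge set0I V0. Qed.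

Let nu_fin A : measurable A -> restricted_charge A \is a fin_num.
Proof. by []. Qed.

Let nu_sigma_additive : semi_sigma_additive restricted_charge.
Proof.
move=> F mF tF mUF; have [_ V_add _] := mV.
have := V_add (fun k => F k `&` D); rewrite -setI_bigcupl => VF.
rewrite /restricted_charge; under eq_fun do rewrite sumEFin.
apply: cvg_EFin; first exact: nearW.
apply: VF.
- by move=> k; exact: measurableI.
- exact: trivIset_setIr.
- by apply: bounded_subset bD => x [].
Qed.

HB.instance Definition _ := isCharge.Build _ _ _ restricted_charge
  nu0 nu_fin nu_sigma_additive.

Hypothesis V_null : forall A : set (borelR3 R), measurable A ->
  bounded_set (A : set (R3 R)) -> mu A = 0%E -> V A = 0.

Lemma restricted_charge_density : exists g : R3 R -> R,
  mu.-integrable setT (EFin \o g) /\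
  forall A, measurable A -> A `<=` D -> (V A)%:E = (\int[mu]_(x in A) (g x)%:E)%E.
Proof.
pose mu' : {sigma_finite_measure set (borelR3 R) -> \bar R} :=
  @leb3_set_function R.
have numu : restricted_charge `<< mu'.
  apply/null_content_dominatesP => A mA muA.
  rewrite /restricted_charge V_null//; first exact: measurableI.
    by apply: bounded_subset bD => x [].
  apply/eqP; rewrite eq_le measure_ge0 andbT -[leRHS]muA.
  by apply: le_measure; rewrite ?inE//; exact: measurableI.
pose g := Radon_Nikodym restricted_charge mu'.
have gE : EFin \o (fine \o g) = g.
  by apply/funext => x /=; rewrite fineK// Radon_Nikodym_fin_num.
exists (fine \o g); split; first by rewrite gE; exact: (Radon_Nikodym_integrable numu).
move=> A mA AD; transitivity (restricted_charge A); first by rewrite /restricted_charge setIidl.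
apply: (etrans (Radon_Nikodym_integral numu mA)).
by apply: eq_integral => x _; rewrite fineK// Radon_Nikodym_fin_num.
Qed.

End restricted_charge.

Section density_exists.
Variable R : realType.
Local Notation mu := (leb3 R).

(** The space is cut into disjoint bounded shells, a density is taken on each, and these are glued.
    A ball meets finitely many shells, which gives local integrability; countable additivity of [V]
    on bounded sets gives the formula. *)
Lemma ac_loc_measure_density (V : set (R3 R) -> R) : loc_measure V ->
    (forall A : set (borelR3 R), measurable A ->
      bounded_set (A : set (R3 R)) -> mu A = 0%E -> V A = 0) ->
  abs_continuous_L1loc V.
Proof.
move=> mV V_null; have [_ V_add _] := mV.
pose B n : set (borelR3 R) := ball (0 : R3 R) n.+1%:R.
have mB n : measurable (B n) by exact: measurable_ball3.
have bB n : bounded_set (B n : set (R3 R)) by exact: ball3_bounded.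
have ndB m n : (m <= n)%N -> B m `<=` B n by move=> mn; apply: le_ball; rewrite ler_nat.
pose S := seqDU B.
have SB n : S n `<=` B n by move=> x [].
have mS n : measurable (S n).
  by apply: measurableD => //; exact: bigsetU_measurable.
have bS n : bounded_set (S n : set (R3 R)) by apply: bounded_subset (bB n).
have tS : trivIset setT S by exact: trivIset_seqDU.
have US : \bigcup_n S n = setT by rewrite -seqDU_bigcup_eq bigcup_ball3.
have Sfar N k : (N < k)%N -> B N `&` S k = set0.
  move=> Nk; apply/seteqP; split => // x [BNx [_]]; apply.
  by rewrite -bigcup_mkord; exists N.
have [g gP] := choice (fun n => restricted_charge_density (mS n) (bS n) mV V_null).
have Sx (x : R3 R) : exists n, S n x.
  have [n _ Snx] : (\bigcup_n S n) x by rewrite US.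
  by exists n.
have [k kS] := choice Sx.
(* Here [k x] is the index of the only shell that contains [x], so [f] coincides with [g n] on
   [S n]. *)
pose f x := g (k x) x.
have kE n x : S n x -> k x = n.
  move=> Snx; apply: (tS _ _ I I); exists x; split => //; exact: kS.
have mf : measurable_fun setT (f : borelR3 R -> R).
  rewrite -US; apply/(measurable_fun_bigcup _ mS) => n.
  apply: (eq_measurable_fun (g n)) => [x /[!inE] Snx|]; first by rewrite /f (kE n).
  have [/measurable_int /measurable_EFinP gn _] := gP n.
  exact: measurable_funTS.
have mnf : measurable_fun setT (fun x : borelR3 R => `|f x|%:E).
  by apply/measurable_EFinP; exact: measurableT_comp.
have finB N : (\int[mu]_(x in B N) `|f x|%:E < +oo)%E.
  have -> : B N = \big[setU/set0]_(n <- iota 0 N.+1) S n.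
    rewrite -[iota _ _]/(index_iota 0 N.+1) big_mkord -bigcup_mkord.
    apply/seteqP; split => [x BNx|x [n /= nN /SB]]; last exact: ndB.
    have [n _ Snx] : (\bigcup_n S n) x by rewrite US.
    exists n => //=; rewrite ltnS leqNgt; apply/negP => /Sfar.
    by move/seteqP => [/(_ x)] + _; apply.
  rewrite ge0_integral_bigsetU//; last 3 first.
  - exact: iota_uniq.
  - exact: sub_trivIset tS.
  - exact: measurable_funTS.
  apply: lte_sum_pinfty => n _; have [/integrableP[gm gi] _] := gP n.
  apply: le_lt_trans gi.
  have -> : (\int[mu]_(x in S n) `|f x|%:E = \int[mu]_(x in S n) `|(EFin \o g n) x|)%E.
    by apply: eq_integral => x /[!inE] Snx; rewrite /f (kE n).
  by apply: ge0_subset_integral => //; exact: measurableT_comp.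
have lf : loc_integrable3 f.
  split => // K cK; have /bounded_set_ball3[N KN] := compact_bounded cK.
  apply: le_lt_trans (finB N); apply: ge0_subset_integral => //.
  - exact: compact_measurable3.
  - exact: measurable_funTS.
exists f; split => // A mA bA.
have iA := loc_integrable3_integrable lf mA bA.
pose F n := A `&` S n.
have UF : \bigcup_n F n = A by rewrite -setI_bigcupr US setIT.
have tF : trivIset setT F by exact: trivIset_setIl.
have mF n : measurable (F n) by exact: measurableI.
have bF n : bounded_set (F n : set (R3 R)) by apply: bounded_subset (bS n) => x [].
have VFE n : (V (F n))%:E = (\int[mu]_(x in F n) (f x)%:E)%E.
  have [_ ->//] := gP n; last by move=> x [].
  by apply: eq_integral => x /[!inE] -[_ Snx]; rewrite /f (kE n).
apply: EFin_inj; rewrite /density fineK ?integrable_fin_num//.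
(* Both [V A] and the integral over [A] are sums over the shells, with equal terms by [VFE]. *)
rewrite -{2}UF integral_bigcup ?UF//.
have := V_add F mF tF; rewrite UF => /(_ bA) VA.
apply/esym/cvg_lim => //.
under eq_fun do under eq_bigr do rewrite -VFE.
under eq_fun do rewrite sumEFin.
by apply: cvg_EFin; [exact: nearW|exact: VA].
Qed.

End density_exists.

(** * The theorem *)

Section kato_class.
Variable R : realType.
Local Notation mu := (leb3 R).
Implicit Types (f phi : R3 R -> R) (V : set (R3 R) -> R) (x y : R3 R).

Lemma kato_potential_le_norm V y : (kato_potential V setT y <= kato_norm V)%E.
Proof. by apply: ereal_sup_ubound; exists y. Qed.

Lemma normr_le_tvar V (A : set (borelR3 R)) : V set0 = 0 -> measurable A ->
  bounded_set (A : set (R3 R)) -> (`|V A|%:E <= tvar V A)%E.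
Proof.
move=> V0 mA bA; apply: ereal_sup_ubound; exists 1%N, (bigcup2 A set0); split.
- by move=> [|[|k]]; rewrite /bigcup2/=; split => //; apply: bounded_subset bA.
- by rewrite -trivIset_bigcup2 setI0.
- by rewrite big_ord1.
Qed.

Lemma tvar_set0 V : V set0 = 0 -> tvar V set0 = 0%E.
Proof.
move=> V0; apply/eqP; rewrite eq_le; apply/andP; split.
  apply: ge_ereal_sup => _ [n [F [FP _ ->]]]; rewrite big1// => k _.
  have [_ _] := FP k; rewrite subset0 => ->; by rewrite V0 normr0.
have b0 : bounded_set (set0 : set (R3 R)).
  by apply: bounded_subset (ball3_bounded 0 0); exact: sub0set.
by have := @normr_le_tvar V set0 V0 measurable0 b0; rewrite V0 normr0.
Qed.

(** On the sup-norm ball of radius [n + 1] the Euclidean distance to 0 is less than [3 (n + 1)], so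
    the kernel centred at 0 is bounded below there. *)
Lemma tvar_le_kato_norm V (A : set (borelR3 R)) n : V set0 = 0 -> measurable A ->
  A `<=` ball (0 : R3 R) n.+1%:R ->
  ((3 * n.+1%:R)^-1%:E * tvar V A <= kato_norm V)%E.
Proof.
move=> V0 mA An; apply: (le_trans _ (kato_potential_le_norm V 0)).
apply: set_function_integral_ge_cst => //.
- exact: tvar_set0.
- by move=> x; exact: kernel3_ge0.
- move=> x /An /ball3_edist xn; rewrite -[X in (_ <= X)%E]/(kernel3 0 x) kernel3E.
  have [//|x0] := eqVneq; first by rewrite leey.
  have xpos : 0 < edist x 0 by rewrite lt_neqAle eq_sym x0 edist3_ge0.
  by rewrite lee_fin lef_pV2 ?posrE ?mulr_gt0// ltW.
Qed.

Lemma Ccinfty_continuous phi : Ccinfty phi -> continuous phi.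
Proof. by move=> [/(_ [::])[]]. Qed.

Lemma Ccinfty_ball3 phi : Ccinfty phi ->
  exists n, forall x, phi x != 0 -> ball (0 : R3 R) n.+1%:R x.
Proof.
move=> [_ /compact_bounded/bounded_set_ball3[n hn]]; exists n => x phix.
by apply: hn; exact: subset_closure.
Qed.

Lemma Ccinfty_bounded phi : Ccinfty phi ->
  exists2 M : R, 0 < M & forall x, `|phi x| <= M.
Proof.
move=> phiC; have cphi := Ccinfty_continuous phiC; have [_ cK] := phiC.
have : compact (phi @` closure [set x | phi x != 0]).
  by apply: continuous_compact => //; exact: continuous_subspaceT.
move=> /compact_bounded /ex_strict_bound_gt0[M M0 phiM]; exists M => // x.
have [->|phix] := eqVneq (phi x) 0; first by rewrite normr0 ltW.
by apply/ltW/phiM; exists x => //; exact: subset_closure.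
Qed.

Lemma Ccinfty_loc_integrable3 phi : Ccinfty phi -> loc_integrable3 phi.
Proof.
move=> phiC; have mphi := continuous_measurable3 (Ccinfty_continuous phiC).
have [M M0 phiM] := Ccinfty_bounded phiC.
split => // K cK.
have mK := compact_measurable3 cK.
apply: (@le_lt_trans _ _ (\int[mu]_(x in K) M%:E)%E).
  apply: ge0_le_integral => //.
  - by apply: measurable_funTS; apply/measurable_EFinP; exact: measurableT_comp.
  - by move=> x _; rewrite lee_fin.
rewrite integral_cst// lte_mul_pinfty ?lee_fin ?(ltW M0)//.
by apply: leb3_bounded_lty mK _; exact: compact_bounded cK.
Qed.

Lemma loc_integrable3B f phi : loc_integrable3 f -> loc_integrable3 phi ->
  loc_integrable3 (fun x => f x - phi x).
Proof.
move=> [mf fK] [mp pK]; split; first exact: measurable_funB.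
move=> K cK.
have mK := compact_measurable3 cK.
have nK (h : R3 R -> R) : measurable_fun setT (h : borelR3 R -> R) ->
    measurable_fun (K : set (borelR3 R)) (fun x => `|h x|%:E).
  by move=> mh; apply: measurable_funTS; apply/measurable_EFinP; exact: measurableT_comp.
apply: (@le_lt_trans _ _ (\int[mu]_(x in K) (`|f x|%:E + `|phi x|%:E))%E).
  apply: ge0_le_integral => //.
  - by apply: nK; exact: measurable_funB.
  - by apply: emeasurable_funD; exact: nK.
  - by move=> x _; rewrite -EFinD lee_fin ler_normB.
by rewrite ge0_integralD//; [rewrite lte_add_pinfty ?fK ?pK|exact: nK|exact: nK].
Qed.

Lemma kato_potential_densityB f phi V (D : set (borelR3 R)) y :
    loc_integrable3 f -> loc_integrable3 phi ->
    (forall A, measurable A -> bounded_set (A : set (R3 R)) -> V A = density f A) ->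
    measurable D ->
  kato_potential (V \- density phi)%R D y = kato_integral (fun x => f x - phi x) D y.
Proof.
move=> lf lp Vf mD; apply: kato_potential_density => //; first exact: loc_integrable3B.
move=> A mA bA /=; rewrite Vf// /density RintegralB//; exact: loc_integrable3_integrable.
Qed.

(** A test density does not charge the null set [A], so [V A] is the value at [A] of the difference
    [V - phi dx]. By [tvar_le_kato_norm] this is bounded by [3 (n + 1)] times a Kato norm that can
    be made arbitrarily small. *)
Lemma kato0_null V (A : set (borelR3 R)) : kato0 V -> measurable A ->
  bounded_set (A : set (R3 R)) -> mu A = 0%E -> V A = 0.
Proof.
move=> [[[V0 _ _] _] VK] mA bA A0; have [n An] := bounded_set_ball3 bA.
have n0 : 0 < 3 * n.+1%:R :> R by rewrite mulr_gt0.
apply/eqP; rewrite -normr_eq0; apply/eqP/le_anti; rewrite normr_ge0 andbT.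
apply/ler_addgt0Pr => e e0; rewrite add0r.
have [|phi [phiC Vphi]] := VK (e / (3 * n.+1%:R)); first by rewrite divr_gt0.
have mphi := continuous_measurable3 (Ccinfty_continuous phiC).
pose W := (V \- density phi)%R.
have d0 (B : set (borelR3 R)) : measurable B -> mu B = 0%E -> density phi B = 0.
  move=> mB B0; rewrite /density /Rintegral null_set_integral//.
  by apply: measurable_funTS; exact/measurable_EFinP.
have W0 : W set0 = 0 by rewrite /W/= V0 d0 ?subr0//; exact: measure0.
have WA : W A = V A by rewrite /W/= d0// subr0.
have := tvar_le_kato_norm W0 mA An => /le_lt_trans/(_ Vphi)/ltW.
have := normr_le_tvar W0 mA bA; rewrite WA => h1 h2.
have : ((3 * n.+1%:R)^-1%:E * `|V A|%:E <= (e / (3 * n.+1%:R))%:E)%E.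
  by apply: le_trans h2; rewrite lee_wpmul2l// lee_fin invr_ge0 ltW.
by rewrite -EFinM lee_fin mulrC ler_pM2r// invr_gt0.
Qed.

End kato_class.

(** * The two implications, for a measure with a density *)

Section equivalence.
Variable R : realType.
Local Notation mu := (leb3 R).
Implicit Types (f phi : R3 R -> R) (V : set (R3 R) -> R) (x y : R3 R).

Definition far3 (r : R) : set (borelR3 R) := [set x | r < edist x 0].

Lemma measurable_far3 r : measurable (far3 r).
Proof.
have := @measurable_edist R 0 measurableT _ (measurable_itv `]r, +oo[).
by rewrite setTI; congr measurable; apply/seteqP; split => x; rewrite /= in_itv/= andbT.
Qed.

Lemma sup_kato_potential_ge0 V f (D : R3 R -> set (borelR3 R)) : loc_integrable3 f ->
    (forall A, measurable A -> bounded_set (A : set (R3 R)) -> V A = density f A) ->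
    (forall y, measurable (D y)) ->
  (0 <= ereal_sup (range (fun y => kato_potential V (D y) y)))%E.
Proof.
move=> lf Vf mD; apply: (@le_trans _ _ (kato_potential V (D 0) 0)).
  by rewrite (kato_potential_density _ lf Vf)// kato_integral_ge0.
by apply: ereal_sup_ubound; exists 0.
Qed.

(** Write [f = (f - phi) + phi]. The first term is small in Kato norm over the whole space; the
    second is bounded by some [M], so on small balls it is controlled by [M] times the integral for
    the constant 1. *)
Lemma kato0_local V f : loc_integrable3 f ->
    (forall A, measurable A -> bounded_set (A : set (R3 R)) -> V A = density f A) ->
  kato0 V -> local_kato V.
Proof.
move=> lf Vf [_ VK]; have [mf _] := lf; rewrite /local_kato.
apply: ge0_cvge0.
  move=> r; apply: (sup_kato_potential_ge0 (D := fun y => eball3 y r) lf Vf) => y.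
  exact: measurable_eball3.
move=> e e0; have e20 : 0 < e / 2 by rewrite divr_gt0.
have [phi [phiC Vphi]] := VK _ e20.
have lphi := Ccinfty_loc_integrable3 phiC; have [mphi _] := lphi.
have [M M0 phiM] := Ccinfty_bounded phiC.
have [r r0 rK] := @uniform_kato1 R (e / 2 / M) (divr_gt0 e20 M0).
near=> s; have s0 : 0 < s by near: s; exact: nbhs_right_gt.
have sr : s <= r by near: s; exact: nbhs_right_le.
apply: ge_ereal_sup => _ [y _ <-].
have mS := measurable_eball3 y s.
rewrite -/(eball3 y s) (kato_potential_density _ lf Vf)// [e]splitr EFinD.
apply: (@le_trans _ _ (kato_integral (fun x => f x - phi x)%R (eball3 y s) y +
    kato_integral phi (eball3 y s) y)%E).
  apply: le_kato_integralD => //; first exact: measurable_funB.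
  by move=> x _; rewrite -{1}[f x](subrK (phi x)) ler_normD.
apply: leeD.
  apply: (@le_trans _ _ (kato_integral (fun x => f x - phi x)%R setT y)).
    by apply: subset_kato_integral => //; exact: measurable_funB.
  rewrite -(kato_potential_densityB y lf lphi Vf)//.
  by rewrite (le_trans (kato_potential_le_norm _ _))// ltW.
apply: (@le_trans _ _ (kato_integral (fun=> M * 1)%R (eball3 y s) y)).
  by apply: le_kato_integral => // x _; rewrite mulr1 (ger0_norm (ltW M0)).
rewrite (@kato_integralZ _ M (fun=> 1%R))// (ger0_norm (ltW M0)).
rewrite -[e / 2](divfK (lt0r_neq0 M0)) [(_ * M)%R]mulrC EFinM lee_wpmul2l ?lee_fin ?(ltW M0)//.
apply: le_trans (rK y); apply: subset_kato_integral => //; first exact: measurable_eball3.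
by move=> x /lt_le_trans; exact.
Unshelve. all: by end_near. Qed.

(** Far from the origin [phi] vanishes, so there [f] equals [f - phi], which is small in Kato
    norm. *)
Lemma kato0_distal V f : loc_integrable3 f ->
    (forall A, measurable A -> bounded_set (A : set (R3 R)) -> V A = density f A) ->
  kato0 V -> modified_distal_kato V.
Proof.
move=> lf Vf [_ VK]; have [mf _] := lf; rewrite /modified_distal_kato.
apply: ge0_cvge0.
  move=> r; apply: (sup_kato_potential_ge0 (D := fun=> far3 r) lf Vf) => y.
  exact: measurable_far3.
move=> e e0; have [phi [phiC Vphi]] := VK _ e0.
have lphi := Ccinfty_loc_integrable3 phiC; have [mphi _] := lphi.
have [n phin] := Ccinfty_ball3 phiC.
near=> r; apply: ge_ereal_sup => _ [y _ <-].
have mF := measurable_far3 r.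
rewrite -/(far3 r) (kato_potential_density _ lf Vf)//.
apply: (@le_trans _ _ (kato_integral (fun x => f x - phi x)%R (far3 r) y)).
  apply: le_kato_integral => //; first exact: measurable_funB.
  move=> x rx; have [->|/phin/ball3_edist xn] := eqVneq (phi x) 0; first by rewrite subr0.
  have : r < 3 * n.+1%:R by exact: lt_trans xn.
  by rewrite ltNge; case/negP; near: r; apply: nbhs_pinfty_ge; exact: num_real.
apply: (@le_trans _ _ (kato_integral (fun x => f x - phi x)%R setT y)).
  by apply: subset_kato_integral => //; exact: measurable_funB.
rewrite -(kato_potential_densityB y lf lphi Vf)//.
by rewrite (le_trans (kato_potential_le_norm _ _))// ltW.
Unshelve. all: by end_near. Qed.

Lemma local_kato_uniform V f : loc_integrable3 f ->
    (forall A, measurable A -> bounded_set (A : set (R3 R)) -> V A = density f A) ->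
  local_kato V -> uniform_kato f.
Proof.
move=> lf Vf hV e e0; have h := cvge0_lt hV e0.
have [r [r0 hr]] := filter_ex (filterI (nbhs_right_gt (0 : R)) h).
exists r => // y.
rewrite -(kato_potential_density y lf Vf (measurable_eball3 y r)).
by apply: le_trans (ltW hr); apply: ereal_sup_ubound; exists y.
Qed.

(** With a large box [Q], write [f - phi = f (1 - 1_Q) + (f 1_Q - phi)]. The distal property bounds
    the first term, and [kato_approx_cut] provides [phi] for the second. *)
Lemma local_distal_kato0 V f : kato V -> loc_integrable3 f ->
    (forall A, measurable A -> bounded_set (A : set (R3 R)) -> V A = density f A) ->
  local_kato V -> modified_distal_kato V -> kato0 V.
Proof.
move=> VK lf Vf /(local_kato_uniform lf Vf) fK Vd; split => // e e0.
have [mf _] := lf.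
have e30 : 0 < e / 3 by rewrite divr_gt0.
have h := cvge0_lt Vd e30.
have [r [r0 hr]] := filter_ex (filterI (nbhs_pinfty_gt (num_real (0 : R))) h).
(* The added 1 puts the closed Euclidean ball of radius [r] inside the open box, so that [1 - 1_Q]
   vanishes off [far3 r]. *)
pose N := r + 1; pose Q := box3 (- N, - N, - N) (N, N, N).
have mQ : measurable Q by exact: measurable_box3.
have [_ fQ] := kato_approx_cut mf fK (loc_integrable3_integrable lf mQ (bounded_box3 _ _)).
have [phi tphi fphi] := fQ _ e30.
have mphi := measurable_test_function tphi.
have phiC := test_function_Ccinfty tphi.
exists phi; split => //.
(* The supremum over [y] preserves only weak inequalities; the remaining third of [e] makes the
   bound strict. *)
apply: (@le_lt_trans _ _ (e / 3 + e / 3)%:E); last by rewrite lte_fin; lra.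
apply: ge_ereal_sup => _ [y _ <-].
rewrite (kato_potential_densityB y lf (Ccinfty_loc_integrable3 phiC) Vf)// EFinD.
have m1 : measurable_fun setT (\1_Q : borelR3 R -> R) by exact: measurable_indic.
have mfar : measurable_fun setT (fun x : borelR3 R => f x * (1 - \1_Q x)).
  by apply: measurable_funM => //; exact: measurable_funB.
apply: (@le_trans _ _ (kato_integral (fun x => f x * (1 - \1_Q x))%R setT y +
   kato_integral (fun x => f x * \1_Q x - phi x)%R setT y)%E).
  apply: le_kato_integralD => //.
  - exact: measurable_funB.
  - by apply: measurable_funB => //; exact: measurable_funM.
  - move=> x _; apply: le_trans (ler_normD _ _).
    by rewrite le_eqVlt; apply/orP; left; apply/eqP; congr `|_|; ring.
apply: leeD; last exact: fphi.
apply: (@le_trans _ _ (kato_integral f (far3 r) y)); last first.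
  rewrite -(kato_potential_density _ lf Vf); last exact: measurable_far3.
  by apply: le_trans (ltW hr); apply: ereal_sup_ubound; exists y.
have mF := measurable_far3 r.
rewrite (kato_integral_setD y mfar mF measurableT) setTI setTD.
have -> : kato_integral (fun x => f x * (1 - \1_Q x))%R (~` far3 r) y = 0%E.
  apply: integral0_eq => x /negP; rewrite -leNgt => xr.
  have [h1 h2 h3] := edist_coordP x 0.
  suff Qx : Q x by rewrite indicE mem_set// subrr mulr0 normr0 mul0e.
  move: h1 h2 h3; rewrite /Q /box3 !subr0 => h1 h2 h3.
  by split; [split|]; rewrite /= in_itv/= -ltr_norml /N;
    [move: h1|move: h2|move: h3] => /le_lt_trans; apply; rewrite (le_lt_trans xr)// ltrDl.
rewrite adde0; apply: le_kato_integral => // x _.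
rewrite normrM ler_piMr// indicE.
case: (x \in Q); first by rewrite subrr normr0 ler01.
by rewrite subr0 normr1.
Qed.

End equivalence.

Theorem lemma1p6 (R : realType) (V : set (R3 R) -> R) (hV : kato V) :
  kato0 V <->
  [/\ local_kato V, modified_distal_kato V & abs_continuous_L1loc V].
Proof.
split=> [V0|[Vl Vd [f [lf Vf]]]]; last exact: local_distal_kato0 hV lf Vf Vl Vd.
(* The density comes first: the local and distal properties are derived from it. *)
have Vac : abs_continuous_L1loc V.
  by apply: ac_loc_measure_density => [|A mA bA A0]; [case: hV|exact: kato0_null A0].
have [f [lf Vf]] := Vac.
by split => //; [exact: kato0_local lf Vf V0|exact: kato0_distal lf Vf V0].
Qed.
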